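(* For $m\ge1$: (a) if $n\ge3$, each of $h_m[\ell_n],h_m[\pi_n],e_m[\ell_n],e_m[\pi_n]$ is bounded by $m(n-1)$; (b) $h_m[\ell_2]$ is sharply bounded by $m$; (c) $e_m[\pi_2]$ is sharply bounded by $m+1$; (d) if $\lambda$ has no part equal to $1$ and $\mathrm{rank}(\lambda)=i$, then $\mathrm{Lie}_\lambda$ is bounded by $i$ and $W_\lambda$ is bounded by $i+1$; (e) for $i\ge1$, writing $\bigoplus_{m}\widehat{\mathrm{Lie}}^i_m=\sum_\mu c_\mu\chi^\mu$ one has $\max\{|\mu|+\mu_1:c_\mu\ne0\}=3i$, and writing $\bigoplus_m\widehat W^i_m=\sum_\mu c_\mu\chi^\mu$ one has $\max\{|\mu|+\mu_1:c_\mu\ne0\}=3i+1$.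
   Context: Let $C_n\subset S_n$ be generated by an $n$-cycle $c$, $\chi_\zeta$ a linear character of $C_n$ sending $c$ to a primitive $n$-th root of unity, $\mathrm{Lie}_{(n)}=\chi_\zeta\uparrow_{C_n}^{S_n}$, $\ell_n=\mathrm{ch}(\mathrm{Lie}_{(n)})$ (Frobenius characteristic), $\pi_n=\omega(\ell_n)$; $f[g]$ is plethysm. For $\lambda=1^{m_1}2^{m_2}\cdots$, $\mathrm{ch}(\mathrm{Lie}_\lambda)=\prod_j h_{m_j}[\ell_j]$, $\mathrm{ch}(W_\lambda)=\prod_{j\text{ odd}}h_{m_j}[\pi_j]\prod_{j\text{ even}}e_{m_j}[\pi_j]$; $\mathrm{rank}(\lambda)=|\lambda|-\ell(\lambda)$. $\widehat{\mathrm{Lie}}^i_m=\bigoplus\mathrm{Lie}_\lambda$ and $\widehat W^i_m=\bigoplus W_\lambda$ over partitions $\lambda$ of $m$ with no part $1$ and rank $i$. A symmetric function or character $\sum_\lambda c_\lambda s_\lambda$ (resp. $\sum c_\lambda\chi^\lambda$) is bounded by $N$ if $c_\lambda\ne0$ implies $\lambda_1\le N$, and sharply bounded by $N$ if $N$ is the smallest such number. *)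

(* Defs.v *)
(* Symmetric functions are encoded in the power-sum basis:
   a symmetric function f (over algC) is the function sending a partition
   rho (nonincreasing seq of positive nats) to the coefficient of p_rho in f. *)
From HB Require Import structures.
From mathcomp Require Import all_boot all_order all_algebra all_fingroup all_solvable all_field all_character.
Set Implicit Arguments. Unset Strict Implicit. Unset Printing Implicit Defensive.
Import Order.TTheory GRing.Theory Num.Theory.
Local Open Scope ring_scope.

Definition symf := seq nat -> algC.

Definition is_partition (r : seq nat) : bool :=
  sorted geq r && all (fun x => 0 < x)%N r.

Fixpoint parts_aux (fuel m k : nat) : seq (seq nat) :=
  if m == 0%N then [:: [::]] else
  match fuel with
  | 0 => [::]
  | f'.+1 => flatten [seq [seq j :: p | p <- parts_aux f' (m - j) j]
                     | j <- iota 1 (minn m k)]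
  end.
Definition partitions (m : nat) : seq (seq nat) := parts_aux m m m.

Definition zee (r : seq nat) : nat :=
  \prod_(i <- undup r) (i ^ count_mem i r * (count_mem i r)`!)%N.

Definition prank (l : seq nat) : nat := (sumn l - size l)%N.

Definition zerof : symf := fun _ => 0.
Definition onef : symf := fun r => (r == [::])%:R.
Definition addf (f g : symf) : symf := fun r => f r + g r.

Fixpoint bitseqs (n : nat) : seq bitseq :=
  if n is n'.+1 then [seq b :: s | b <- [:: true; false], s <- bitseqs n']
  else [:: [::]].
Definition splits (r : seq nat) : seq (seq nat * seq nat) :=
  undup [seq (mask b r, mask (map negb b) r) | b <- bitseqs (size r)].
(* product: p_sigma * p_tau = p_(sigma U tau) *)
Definition mulf (f g : symf) : symf :=
  fun r => \sum_(p <- splits r) f p.1 * g p.2.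
Definition prodf (fs : seq symf) : symf := foldr mulf onef fs.

Definition hsym (m : nat) : symf := fun r =>
  if (sumn r == m) && is_partition r then (zee r)%:R^-1 else 0.
Definition esym (m : nat) : symf := fun r =>
  if (sumn r == m) && is_partition r
  then (-1) ^+ (m - size r) * (zee r)%:R^-1 else 0.

Definition omega (f : symf) : symf := fun r => (-1) ^+ (sumn r - size r) * f r.

(* g |-> p_k[g] (replace p_j by p_{jk}) *)
Definition adams (k : nat) (g : symf) : symf := fun r =>
  if all (fun x => k %| x)%N r then g [seq (x %/ k)%N | x <- r] else 0.
(* plethysm f[g] for f homogeneous of degree m:
   f = sum_{sigma |- m} f_sigma p_sigma, p_sigma[g] = prod_i p_{sigma_i}[g] *)
Definition pleth (m : nat) (f g : symf) : symf := fun r =>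
  \sum_(s <- partitions m) f s * prodf [seq adams k g | k <- s] r.

Definition jt (l : seq nat) (i j : nat) : symf :=
  let a := nth 0%N l i in
  if (a + j < i)%N then zerof else hsym (a + j - i).
Definition schur (l : seq nat) : symf := fun r =>
  \sum_(s : 'S_(size l))
     (-1) ^+ s * prodf [seq jt l (val i) (val (s i)) | i : 'I_(size l) <- enum 'I_(size l)] r.

(* Hall inner product <p_rho, p_sigma> = z_rho delta; coefficient of s_l in f *)
Definition scoef (f : symf) (l : seq nat) : algC :=
  \sum_(r <- partitions (sumn l)) (zee r)%:R * f r * schur l r.

Definition bounded (f : symf) (N : nat) : Prop :=
  forall l, is_partition l -> scoef f l != 0 -> (head 0%N l <= N)%N.
Definition sharply_bounded (f : symf) (N : nat) : Prop :=
  bounded f N /\ forall M, bounded f M -> (N <= M)%N.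

Definition ctype (n : nat) (s : 'S_n) : seq nat :=
  sort geq [seq #|X| | X : {set 'I_n} <- enum (porbits s)].
Definition frob (n : nat) (chi : 'CF([set: 'S_n])) : symf := fun r =>
  (n`!)%:R^-1 * \sum_(s : 'S_n | ctype s == r) chi s.

Definition ncycle (n : nat) : 'S_n := odflt 1%g [pick s : 'S_n | ctype s == [:: n]].
Definition chi_zeta (n : nat) : 'CF(<[ncycle n]>) :=
  if [pick i : Iirr <[ncycle n]> |
        ('chi_i \is a linear_char) && n.-primitive_root ('chi_i (ncycle n))]
  is Some i then 'chi_i else 0.
Definition LieChar (n : nat) : 'CF([set: 'S_n]) := 'Ind[[set: 'S_n]] (chi_zeta n).

Definition ell (n : nat) : symf := frob (LieChar n).
Definition pi_ (n : nat) : symf := omega (ell n).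

Definition hpl (m : nat) (g : symf) : symf := pleth m (hsym m) g.
Definition epl (m : nat) (g : symf) : symf := pleth m (esym m) g.

Definition chLie (l : seq nat) : symf :=
  prodf [seq hpl (count_mem j l) (ell j) | j <- undup l].
Definition chW (l : seq nat) : symf :=
  prodf [seq (if odd j then hpl (count_mem j l) (pi_ j) else epl (count_mem j l) (pi_ j))
        | j <- undup l].

(* graded direct sums  (+)_m hat-Lie^i_m  and  (+)_m hat-W^i_m *)
Definition hatLie (i : nat) : symf := fun r =>
  \sum_(l <- partitions (sumn r) | (1%N \notin l) && (prank l == i)) chLie l r.
Definition hatW (i : nat) : symf := fun r =>
  \sum_(l <- partitions (sumn r) | (1%N \notin l) && (prank l == i)) chW l r.

Definition max_size_plus_first (f : symf) (K : nat) : Prop :=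
  (exists l, [/\ is_partition l, scoef f l != 0 & (sumn l + head 0 l)%N = K]) /\
  (forall l, is_partition l -> scoef f l != 0 -> (sumn l + head 0 l <= K)%N).

(* Main.v *)
(** The bounds come from splitting off one variable t: f is bounded by N as soon
    as f[X + t] has degree at most N in t, because the first row of the
    Jacobi-Trudi determinant of s_l only involves h_k with k >= l_1, and pairing f
    with h_k g means pairing the coefficient of t^k in f[X + t] with g.  Since
    f[g][X + t] = f[g[X + t]], and g = ell_n or pi_n has no h_n component
    (chi_zeta is neither trivial nor, for n >= 3, the sign character), g[X + t] has
    degree at most n - 1 in t, which bounds the plethysms by m(n - 1).
    For n = 2, ell_2 = e_2 and pi_2 = h_2.  In e_m[h_2 + t h_1 + t^2] the summand
    t^2 contributes at most once, as e_b[t^2] = 0 for b >= 2, so the degree is at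
    most m + 1.  Sharpness follows by reading off the leading coefficients, h_m for
    h_m[e_2] and e_{m-1} for e_m[h_2]; they give coefficient 1 on s_(m,m) and on
    s_(m+1,1^{m-1}).  Finally a partition l without parts 1 and of rank i has size
    at most 2i, with equality only for l = 2^i, so the last claim reduces to n = 2. *)

From mathcomp Require Import mpoly.
Require Import Defs.
From mathcomp Require Import all_boot all_order all_algebra all_fingroup all_solvable all_field all_character.
From mathcomp Require Import ring zify.

Set Implicit Arguments. Unset Strict Implicit. Unset Printing Implicit Defensive.
Import Order.TTheory GRing.Theory Num.Theory.
Local Open Scope ring_scope.
Local Notation mulf := Defs.mulf.

(** * Partitions and their splittings *)

Lemma geq_trans : transitive geq.
Proof. by move=> y x z /= xy yz; apply: leq_trans yz xy. Qed.

Lemma geq_anti : antisymmetric geq.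
Proof. by move=> x y /= /andP[xy yx]; apply/eqP; rewrite eqn_leq; apply/andP. Qed.

Lemma is_partition_cons j p :
  is_partition (j :: p) = [&& (0 < j)%N, all (geq j) p & is_partition p].
Proof.
rewrite /is_partition /= (path_sortedE geq_trans).
by case: (0 < j)%N; case: (all _ p); case: (sorted _ p).
Qed.

(** Each recursive call removes a part [j >= 1] from [m], so fuel [m] never runs out. *)
Lemma mem_parts_aux f m k r : (m <= f)%N ->
  (r \in parts_aux f m k) =
  [&& is_partition r, sumn r == m & all (fun x => x <= k)%N r].
Proof.
elim: f m k r => [|f IH] m k r /=.
  rewrite leqn0 => /eqP ->; rewrite inE.
  case: r => [|j p] //=; rewrite is_partition_cons.
  by case: j => [|j] //=; rewrite andbF.
case: eqP => [->|/eqP m0] lef.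
  rewrite inE; case: r => [|j p] //=; rewrite is_partition_cons.
  by case: j => [|j] //=; rewrite andbF.
apply/flattenP/and3P.
  case=> s /mapP[j]; rewrite mem_iota add1n ltnS leq_min => /and3P[j0 jm jk] ->.
  case/mapP=> p; rewrite IH; last by lia.
  case/and3P=> pp /eqP sp aj ->; rewrite is_partition_cons j0 pp aj /= sp.
  split=> //; first by rewrite subnKC.
  by rewrite jk /=; apply: sub_all aj => x xj; apply: leq_trans xj jk.
case: r => [|j p]; first by case=> _; rewrite /= eq_sym (negPf m0).
rewrite is_partition_cons /= => -[/and3P[j0 aj pp] /eqP sm /andP[jk ak]].
exists [seq j :: q | q <- parts_aux f (m - j) j].
  by apply/mapP; exists j => //; rewrite mem_iota; lia.
rewrite mem_map; last by move=> x y [].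
by rewrite IH; [rewrite pp aj -sm addKn eqxx | lia].
Qed.

Lemma mem_partitions m r : (r \in partitions m) = is_partition r && (sumn r == m).
Proof.
rewrite /partitions mem_parts_aux // andbA andb_idr // => /andP[_ /eqP <-].
apply/allP => x; elim: r => //= j r IH; rewrite inE => /orP[/eqP->|/IH]; lia.
Qed.

Lemma partitions_uniq m : uniq (partitions m).
Proof.
suff H f n k : (n <= f)%N -> uniq (parts_aux f n k) by exact: H.
elim: f n k => [|f IH] {}m k lef /=.
  by case: ifP.
case: ifP => // _; move: (iota_uniq 1 (minn m k)).
have: all (leq 1) (iota 1 (minn m k)).
  by apply/allP => x; rewrite mem_iota => /andP[].
elim: (iota _ _) => //= j js IHj /andP[j0 js0] /andP[jn uj].
rewrite cat_uniq IHj // andbT.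
rewrite map_inj_uniq; last by move=> x y [].
rewrite IH; last by lia.
rewrite andTb; apply/hasPn => x /flattenP[s /mapP[i ii ->]] /mapP[p _ ->].
apply/negP => /mapP[q _ [ij _]]; by rewrite -ij ii in jn.
Qed.

(** Unlike [splits], this list keeps repetitions. The multiplicity of [(s, t)] is the number of ways
    to pick [s] among the parts of [r], and induction on [r] is direct. *)
Definition masks (r : seq nat) : seq (seq nat * seq nat) :=
  [seq (mask b r, mask (map negb b) r) | b <- bitseqs (size r)].

Lemma masks_cons x r : masks (x :: r) =
  [seq (x :: p.1, p.2) | p <- masks r] ++ [seq (p.1, x :: p.2) | p <- masks r].
Proof. by rewrite /masks /= cats0 map_cat -!map_comp. Qed.

Lemma big_masks_cons (R : nmodType) x r (F : seq nat * seq nat -> R) :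
  \sum_(p <- masks (x :: r)) F p =
  \sum_(p <- masks r) F (x :: p.1, p.2) + \sum_(p <- masks r) F (p.1, x :: p.2).
Proof. by rewrite masks_cons big_cat; congr (_ + _); rewrite big_map. Qed.

Lemma splitsE r : splits r = undup (masks r).
Proof. by []. Qed.

Lemma masksP r p : p \in masks r ->
  [/\ subseq p.1 r, subseq p.2 r & perm_eq (p.1 ++ p.2) r].
Proof.
elim: r p => [|x r IH] p; first by rewrite inE => /eqP ->.
rewrite masks_cons mem_cat => /orP[] /mapP[q /IH [s1 s2 pq]] -> /=.
  split; [by rewrite eqxx | | by rewrite perm_cons].
  by apply: subseq_trans s2 (subseq_cons _ _).
split; [ | by rewrite eqxx | ].
  by apply: subseq_trans s1 (subseq_cons _ _).
by rewrite -cat1s perm_catCA perm_cons.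
Qed.

Lemma zee_cons x r : zee (x :: r) = (x * (count_mem x r).+1 * zee r)%N.
Proof.
rewrite /zee /=; case: ifP => [xr|/negbT xr].
  have xu : x \in undup r by rewrite mem_undup.
  rewrite !(bigD1_seq x xu (undup_uniq r)) /= eqxx add1n expnS factS.
  rewrite (eq_bigr (fun i => i ^ count_mem i r * (count_mem i r)`!)%N); first by ring.
  by move=> i; rewrite eq_sym => /negPf->.
rewrite big_cons eqxx (count_memPn xr) /= expn1 !muln1; congr (_ * _)%N.
apply: eq_big_seq => i; rewrite mem_undup => ir.
by case: eqP ir xr => // -> ->.
Qed.

Lemma zee_gt0 r : all (leq 1) r -> (0 < zee r)%N.
Proof.
elim: r => [|x r IH] /=; first by rewrite /zee big_nil.
by case/andP=> x0 /IH; rewrite zee_cons !muln_gt0 x0.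
Qed.

Lemma is_partition_gt0 r : is_partition r -> all (leq 1) r.
Proof. by case/andP. Qed.

Lemma zee_partition r : is_partition r -> (zee r)%:R != 0 :> algC.
Proof. by move/is_partition_gt0/zee_gt0; rewrite pnatr_eq0 lt0n. Qed.

Lemma sorted_geq_head x s : all (geq x) s -> sorted geq s -> x \in s ->
  exists2 s', s = x :: s' & sorted geq s'.
Proof.
case: s => // y s /= /andP[yx _] ys; rewrite inE => /orP[/eqP ->|xs].
  by exists s => //; apply: path_sorted ys.
exists s; last exact: path_sorted ys.
move: ys; rewrite (path_sortedE geq_trans) => /andP[/allP/(_ _ xs) /= xy _].
by congr (_ :: _); apply/eqP; rewrite eqn_leq yx xy.
Qed.

(** The multiplicity is a product of binomials, equal to z_r / (z_s z_t). In the induction the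
    largest part [x] goes to [s] or to [t]; the two cases contribute [x * zee r] times the
    multiplicity of [x] in [s] and in [t], and these multiplicities add up to that of [x] in
    [x :: r]. *)
Lemma count_masks_zee r s t : sorted geq r -> sorted geq s -> sorted geq t ->
  perm_eq (s ++ t) r ->
  (count_mem (s, t) (masks r) * zee s * zee t = zee r)%N.
Proof.
elim: r s t => [|x r IH] s t.
  by move=> _ _ _ /perm_nilP; case: s => //= ->; rewrite /zee !big_nil.
rewrite /sorted (path_sortedE geq_trans) -!/(sorted _ _) => /andP[xr sr] ss st pst.
have xall : all (geq x) (s ++ t).
  by rewrite (perm_all _ pst) /= leqnn.
move: xall; rewrite all_cat => /andP[xs xt].
have C1 : count_mem (s, t) [seq (x :: p.1, p.2) | p <- masks r] =
   if s is y :: s' then if x == y then count_mem (s', t) (masks r) else 0%N else 0%N.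
  rewrite count_map; case: s {ss pst xs} => [|y s].
    by rewrite (@eq_count _ _ pred0) ?count_pred0 // => p.
  case: (boolP (x == y)) => [/eqP <-|yx].
    by apply: eq_count => -[p1 p2] /=; rewrite !xpair_eqE eqseq_cons eqxx.
  rewrite (@eq_count _ _ pred0) ?count_pred0 // => -[p1 p2] /=.
  by rewrite !xpair_eqE eqseq_cons (negPf yx).
have C2 : count_mem (s, t) [seq (p.1, x :: p.2) | p <- masks r] =
   if t is y :: t' then if x == y then count_mem (s, t') (masks r) else 0%N else 0%N.
  rewrite count_map; case: t {st pst xt C1} => [|y t].
    by rewrite (@eq_count _ _ pred0) ?count_pred0 // => -[p1 p2]; rewrite /= xpair_eqE andbF.
  case: (boolP (x == y)) => [/eqP <-|yx].
    by apply: eq_count => -[p1 p2] /=; rewrite !xpair_eqE eqseq_cons eqxx.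
  rewrite (@eq_count _ _ pred0) ?count_pred0 // => -[p1 p2] /=.
  by rewrite !xpair_eqE eqseq_cons (negPf yx) andbF.
have H1 : (count_mem (s, t) [seq (x :: p.1, p.2) | p <- masks r] * zee s * zee t
  = x * count_mem x s * zee r)%N.
  rewrite C1; have [xins|xns] := boolP (x \in s); last first.
    rewrite (count_memPn xns) muln0 mul0n.
    case: s xns {ss pst xs C1 C2} => [|y s] //=; rewrite inE.
    by case: (x == y).
  have [s' es ss'] := sorted_geq_head xs ss xins.
  move: pst; rewrite es /= perm_cons eqxx zee_cons => pst.
  by rewrite -(IH s' t) //=; lia.
have H2 : (count_mem (s, t) [seq (p.1, x :: p.2) | p <- masks r] * zee s * zee t
  = x * count_mem x t * zee r)%N.
  rewrite C2; have [xins|xns] := boolP (x \in t); last first.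
    rewrite (count_memPn xns) muln0 mul0n.
    case: t xns {st pst xt C1 C2 H1} => [|y t'] //=; rewrite inE.
    by case: (x == y).
  have [t' et st'] := sorted_geq_head xt st xins.
  move: pst; rewrite et -cat1s perm_catCA perm_cons eqxx zee_cons => pst.
  by rewrite -(IH s t') //=; lia.
rewrite masks_cons count_cat !mulnDl H1 H2 zee_cons.
move/seq.permP/(_ (pred1 x)): pst; rewrite count_cat /= eqxx add1n => <-.
by lia.
Qed.

Lemma perm_is_partition_catl s t r : sorted geq s -> perm_eq (s ++ t) r ->
  is_partition r -> is_partition s.
Proof.
move=> ss p /andP[_ ar]; rewrite /is_partition ss /=.
by move: ar; rewrite -(perm_all _ p) all_cat => /andP[].
Qed.

Lemma perm_is_partition_catr s t r : sorted geq t -> perm_eq (s ++ t) r ->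
  is_partition r -> is_partition t.
Proof. by move=> ss; rewrite perm_catC; apply: perm_is_partition_catl. Qed.

Lemma mem_splits r p : is_partition r ->
  (p \in splits r) = [&& is_partition p.1, is_partition p.2 & perm_eq (p.1 ++ p.2) r].
Proof.
move=> pr; rewrite splitsE mem_undup; case: p => s t /=; have /andP[sr _] := pr.
apply/idP/and3P.
  move/masksP => /= [su1 su2 p]; split=> //.
    by apply: perm_is_partition_catl p pr; apply: subseq_sorted sr => //; apply: geq_trans.
  by apply: perm_is_partition_catr p pr; apply: subseq_sorted sr => //; apply: geq_trans.
case=> ps pt p; rewrite -has_pred1 has_count lt0n; apply/eqP => c0.
have /andP[ss _] := ps; have /andP[st _] := pt.
have := count_masks_zee sr ss st p; rewrite c0 !mul0n => /esym z0.
by have := zee_gt0 (is_partition_gt0 pr); rewrite z0.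
Qed.

Lemma sumn_splits r p : p \in splits r -> (sumn p.1 + sumn p.2)%N = sumn r.
Proof.
by rewrite splitsE mem_undup => /masksP[_ _ /perm_sumn <-]; rewrite sumn_cat.
Qed.

Lemma geq_total : total geq.
Proof. by move=> x y /=; exact: leq_total. Qed.

Lemma partition_eqP r r' : is_partition r -> is_partition r' -> perm_eq r r' -> r = r'.
Proof.
by move=> /andP[sr _] /andP[sr' _]; apply: (sorted_eq geq_trans geq_anti).
Qed.

Lemma is_partition_sort s : all (leq 1) s -> is_partition (sort geq s).
Proof. by move=> a; rewrite /is_partition (sort_sorted geq_total) all_sort a. Qed.

(** A pair [(s, t)] of total size [d] is a splitting of exactly one partition, the sorted
    concatenation. Both sums thus run over the same duplicate-free list of pairs. *)
Lemma sum_splits (R : nmodType) d (F : seq nat -> seq nat -> R) :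
  \sum_(r <- partitions d) \sum_(p <- splits r) F p.1 p.2 =
  \sum_(0 <= a < d.+1) \sum_(s <- partitions a) \sum_(t <- partitions (d - a)) F s t.
Proof.
transitivity (\sum_(p <- flatten [seq splits r | r <- partitions d]) F p.1 p.2).
  by rewrite big_flatten big_map.
transitivity (\sum_(p <- flatten [seq flatten [seq [seq (s, t) | t <- partitions (d - a)]
     | s <- partitions a] | a <- index_iota 0 d.+1]) F p.1 p.2); last first.
  rewrite big_flatten big_map; apply: eq_bigr => a _.
  by rewrite big_flatten big_map; apply: eq_bigr => s _; rewrite big_map.
apply: perm_big; apply: uniq_perm.
(* Splittings of distinct partitions are disjoint, since [r] is determined by [p.1 ++ p.2] up to
   order. *)
- have: all is_partition (partitions d).
    by apply/allP => x; rewrite mem_partitions => /andP[].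
  move: (partitions_uniq d); elim: (partitions d) => //= r rs IH /andP[rn urs] /andP[pr prs].
  rewrite cat_uniq undup_uniq IH // andbT /=.
  apply/hasPn => p /flattenP[l /mapP[r' rr' ->]] pr'.
  apply/negP => pr2; case/negP: rn; suff -> : r = r' by [].
  have pr'p : is_partition r' by apply: (allP prs).
  move: pr' pr2; rewrite !mem_splits // => /and3P[_ _ p1] /and3P[_ _ p2].
  by apply: partition_eqP => //; rewrite -(permPl p2).
(* Blocks with distinct [a] are disjoint, since [a] is the size of the first component. *)
- have: all (geq d) (index_iota 0 d.+1).
    by apply/allP => x; rewrite mem_index_iota /=.
  move: (iota_uniq 0 (d.+1 - 0)); rewrite -/(index_iota 0 d.+1).
  elim: (index_iota _ _) => //= a as_ IH /andP[an ua] /andP[ad aad].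
  rewrite cat_uniq IH // andbT; apply/andP; split.
    apply: allpairs_uniq; rewrite ?partitions_uniq // => -[x y] [x' y'] /= _ _ [-> ->] //.
  apply/hasPn => p /flattenP[l /mapP[b bb ->]] /flattenP[l' /mapP[s sb ->]] /mapP[t _ ->].
  apply/negP => /flattenP[l2 /mapP[s2 sb2 ->]] /mapP[t2 _ [e _]].
  move: sb sb2; rewrite -e !mem_partitions => /andP[_ /eqP ->] /andP[_ /eqP ab].
  by rewrite -ab bb in an.
have memI a : (a \in index_iota 0 d.+1) = (a <= d)%N by rewrite mem_index_iota.
move=> [s t]; move: (index_iota 0 d.+1) memI => I memI; apply/flattenP/flattenP.
  case=> l /mapP[r]; rewrite mem_partitions => /andP[pr /eqP sr] -> sp.
  have /= st := sumn_splits sp.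
  exists (flatten [seq [seq (x, y) | y <- partitions (d - sumn s)] | x <- partitions (sumn s)]).
    by apply/mapP; exists (sumn s) => //; rewrite memI; lia.
  move: sp; rewrite mem_splits // => /and3P[/= ps pt _].
  apply/flattenP; exists [seq (s, y) | y <- partitions (d - sumn s)].
    by apply/mapP; exists s; rewrite // mem_partitions ps /=.
  by apply/mapP; exists t; rewrite // mem_partitions pt -sr -st addKn /=.
case=> l /mapP[a]; rewrite memI => ad ->.
case/flattenP=> l' /mapP[s']; rewrite mem_partitions => /andP[ps /eqP sa] -> /mapP[t'].
rewrite mem_partitions => /andP[pt /eqP ta] [-> ->].
have a1 : all (leq 1) (s' ++ t') by rewrite all_cat !is_partition_gt0.
have pm : is_partition (sort geq (s' ++ t')) by exact: is_partition_sort.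
exists (splits (sort geq (s' ++ t'))).
  apply: map_f; rewrite mem_partitions pm /=.
  have /perm_sumn -> : perm_eq (sort geq (s' ++ t')) (s' ++ t') by rewrite perm_sort.
  by rewrite sumn_cat sa ta subnKC.
by rewrite mem_splits //= ps pt /= perm_sym perm_sort.
Qed.

(** * Evaluating symmetric functions *)

(** The specialization sending p_j to [P j]. A [symf] may have infinite support, hence the
    restriction to one degree [d]; [iota] allows values in polynomial rings. *)
Definition ev (A : comNzRingType) (iota : {rmorphism algC -> A}) (P : nat -> A)
    (d : nat) (f : symf) : A :=
  \sum_(r <- partitions d) iota (f r) * \prod_(j <- r) P j.

Definition hom (d : nat) (f : symf) : Prop := forall r, f r != 0 -> sumn r = d.

Lemma sum_masks (R : pzSemiRingType) r (F : seq nat -> seq nat -> R) :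
  \sum_(p <- masks r) F p.1 p.2 =
  \sum_(p <- splits r) (count_mem p (masks r))%:R * F p.1 p.2.
Proof.
rewrite splitsE -[LHS]big_undup_iterop_count; apply: eq_bigr => p _.
by rewrite mulr_natl; case: (count_mem _ _).
Qed.

Lemma prodD_masks (A : comNzRingType) (P Q : nat -> A) r :
  \prod_(j <- r) (P j + Q j) =
  \sum_(p <- masks r) (\prod_(j <- p.1) P j) * (\prod_(j <- p.2) Q j).
Proof.
elim: r => [|x r IH]; first by rewrite big_nil /masks /= big_seq1 !big_nil mulr1.
rewrite big_cons IH mulrDl masks_cons big_cat !big_map /= !mulr_sumr.
by congr (_ + _); apply: eq_bigr => p _; rewrite big_cons; ring.
Qed.

Lemma count_masks r p : is_partition r -> p \in splits r ->
  (count_mem p (masks r))%:R = (zee r)%:R / ((zee p.1)%:R * (zee p.2)%:R) :> algC.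
Proof.
move=> pr; have /andP[sr _] := pr.
rewrite mem_splits // => /and3P[p1 p2 p12].
have /andP[s1 _] := p1; have /andP[s2 _] := p2.
have := count_masks_zee sr s1 s2 p12; rewrite -surjective_pairing => <-.
by rewrite !natrM -[X in X / _]mulrA mulfK // mulf_neq0 ?zee_partition //.
Qed.

Section Eval.
Variables (A : comNzRingType) (iota : {rmorphism algC -> A}).
Implicit Types P Q : nat -> A.

Lemma prodD_splits P Q r : is_partition r ->
  \prod_(j <- r) (P j + Q j) =
  \sum_(p <- splits r) iota ((zee r)%:R / ((zee p.1)%:R * (zee p.2)%:R)) *
     ((\prod_(j <- p.1) P j) * (\prod_(j <- p.2) Q j)).
Proof.
move=> pr; rewrite prodD_masks.
rewrite (sum_masks r (fun s t => (\prod_(j <- s) P j) * \prod_(j <- t) Q j)).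
apply: eq_big_seq => p pin.
by rewrite -count_masks // rmorph_nat.
Qed.

Lemma ev_ext P Q d f g : (forall r, is_partition r -> sumn r = d -> f r = g r) ->
  (forall j, (0 < j <= d)%N -> P j = Q j) -> ev iota P d f = ev iota Q d g.
Proof.
move=> fg PQ; apply: eq_big_seq => r; rewrite mem_partitions => /andP[pr /eqP sr].
rewrite fg //; congr (_ * _); apply: eq_big_seq => j jr; apply: PQ.
have /andP[_ /allP/(_ _ jr) ->] := pr; rewrite -sr.
elim: (r) jr => //= x s IH; rewrite inE => /orP[/eqP->|/IH]; lia.
Qed.

Lemma ev_hom P d e f : hom d f -> e != d -> ev iota P e f = 0.
Proof.
move=> hf ed; rewrite /ev big_seq big1 // => r; rewrite mem_partitions => /andP[_ /eqP sr].
have [->|/hf] := eqVneq (f r) 0; first by rewrite rmorph0 mul0r.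
by rewrite sr => e1; rewrite e1 eqxx in ed.
Qed.

(** Each splitting of [r] only rearranges its parts, so the product of the [P j] factors along it;
    [sum_splits] then regroups by degree. *)
Lemma ev_mul_sum P d f g : ev iota P d (mulf f g) =
  \sum_(0 <= a < d.+1) ev iota P a f * ev iota P (d - a) g.
Proof.
transitivity (\sum_(r <- partitions d) \sum_(p <- splits r)
   (iota (f p.1) * \prod_(j <- p.1) P j) * (iota (g p.2) * \prod_(j <- p.2) P j)).
  apply: eq_big_seq => r; rewrite mem_partitions => /andP[pr _].
  rewrite /mulf rmorph_sum mulr_suml; apply: eq_big_seq => p.
  rewrite mem_splits // => /and3P[_ _ pp].
  by rewrite -(perm_big _ pp) big_cat rmorphM /=; ring.
rewrite (sum_splits _ (fun s t => (iota (f s) * \prod_(j <- s) P j) * (iota (g t) * \prod_(j <- t) P j))).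
apply: eq_bigr => a _; rewrite /ev mulr_suml; apply: eq_bigr => s _.
by rewrite mulr_sumr.
Qed.

Lemma ev_mul P a b f g : hom a f ->
  ev iota P (a + b) (mulf f g) = ev iota P a f * ev iota P b g.
Proof.
move=> hf; rewrite ev_mul_sum (bigD1_seq a) ?iota_uniq //=; last first.
  by rewrite mem_index_iota; lia.
rewrite addKn big1 ?addr0 // => i ia.
by rewrite (ev_hom _ hf ia) mul0r.
Qed.

Lemma ev_one P : ev iota P 0 onef = 1.
Proof. by rewrite /ev /partitions /= big_seq1 big_nil mulr1 /onef eqxx rmorph1. Qed.

Lemma hom_one : hom 0 onef.
Proof. by move=> r; rewrite /onef; have [->|] := eqVneq r [::]; rewrite ?eqxx. Qed.

Lemma hom_mul a b f g : hom a f -> hom b g -> hom (a + b) (mulf f g).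
Proof.
move=> hf hg r fgr; have [p pin] : exists2 p, p \in splits r & f p.1 * g p.2 != 0.
  apply/hasP; apply: contraNT fgr => /hasPn h; rewrite /mulf big_seq big1 // => p /h.
  by rewrite negbK => /eqP.
rewrite mulf_eq0 negb_or => /andP[/hf <- /hg <-].
by rewrite (sumn_splits pin).
Qed.

Lemma hom_prod I (s : seq I) (D : I -> nat) (F : I -> symf) :
  (forall i, hom (D i) (F i)) -> hom (\sum_(i <- s) D i)%N (prodf [seq F i | i <- s]).
Proof.
move=> hF; elim: s => [|i s IH]; first by rewrite big_nil; exact: hom_one.
by rewrite big_cons; apply: hom_mul.
Qed.

Lemma ev_prod P I (s : seq I) (D : I -> nat) (F : I -> symf) :
  (forall i, hom (D i) (F i)) ->
  ev iota P (\sum_(i <- s) D i)%N (prodf [seq F i | i <- s]) =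
  \prod_(i <- s) ev iota P (D i) (F i).
Proof.
move=> hF; elim: s => [|i s IH]; first by rewrite !big_nil; exact: ev_one.
by rewrite !big_cons /= ev_mul // IH.
Qed.

Lemma hom_adams k e g : hom e g -> hom (k * e) (adams k g).
Proof.
move=> hg r; rewrite /adams; case: ifP => [kr /hg <-|_]; last by rewrite eqxx.
rewrite -/(sumn _); elim: r kr {hg} => [|x r IH] /= => [_|/andP[kx /IH ->]]; first by rewrite muln0.
by rewrite mulnDr [(k * (x %/ k))%N]mulnC divnK.
Qed.

(** Only partitions with all parts divisible by [k] contribute, and these are the [k]-fold multiples
    of the partitions of [e]. *)
Lemma ev_adams P k e g : (0 < k)%N ->
  ev iota P (k * e) (adams k g) = ev iota (fun j => P (k * j)%N) e g.
Proof.
move=> k0; rewrite /ev (bigID (fun r => all (fun x => k %| x)%N r)) /=.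
rewrite [X in _ + X]big1 ?addr0; last first.
  by move=> r /negPf h; rewrite /adams h rmorph0 mul0r.
have mK : cancel (map (muln k)) (map (fun x => x %/ k)%N).
  by move=> r; rewrite -map_comp map_id_in // => x _ /=; rewrite mulKn.
transitivity (\sum_(r <- [seq map (muln k) r | r <- partitions e])
   iota (adams k g r) * \prod_(j <- r) P j); last first.
  rewrite big_map; apply: eq_bigr => r _; rewrite /adams all_map.
  rewrite (_ : all _ r = true); last by apply/allP => x _ /=; rewrite dvdn_mulr.
  by rewrite mK big_map.
rewrite -big_filter; apply: perm_big; apply: uniq_perm.
- by rewrite filter_uniq // partitions_uniq.
- by rewrite map_inj_uniq ?partitions_uniq //; apply: can_inj mK.
have homk r : is_partition (map (muln k) r) = is_partition r.
  rewrite /is_partition sorted_map all_map; congr (_ && _).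
    by apply: eq_sorted => x y /=; rewrite leq_pmul2l.
  by apply: eq_all => x /=; rewrite muln_gt0 k0.
have sumk r : sumn (map (muln k) r) = (k * sumn r)%N.
  by elim: r => [|x r IH] /=; rewrite ?muln0 // IH mulnDr.
move=> r; rewrite mem_filter mem_partitions.
apply/and3P/mapP => [[ar pr /eqP sr]|[r']].
  have er : map (muln k) [seq (x %/ k)%N | x <- r] = r.
    by rewrite -map_comp map_id_in // => x /(allP ar) /= kx; rewrite mulnC divnK.
  exists [seq (x %/ k)%N | x <- r] => //.
  rewrite mem_partitions -homk er pr /=.
  by rewrite -(eqn_pmul2l k0) -sr -sumk er.
rewrite mem_partitions => /andP[pr /eqP sr] ->.
rewrite homk sumk sr eqxx; split=> //.
by rewrite all_map; apply/allP => x _ /=; rewrite dvdn_mulr.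
Qed.

Lemma partition_part_gt0 r j : is_partition r -> j \in r -> (0 < j)%N.
Proof. by move=> /andP[_ /allP h] /h. Qed.

Lemma hom_pleth m e f g : hom e g -> hom (m * e) (pleth m f g).
Proof.
move=> hg r hr; have [s sin] : exists2 s, s \in partitions m &
    prodf [seq adams k g | k <- s] r != 0.
  apply/hasP; apply: contraNT hr => /hasPn h; rewrite /pleth big_seq big1 // => s /h.
  by rewrite negbK => /eqP ->; rewrite mulr0.
have h k : hom (k * e) (adams k g) by apply: hom_adams.
move/(@hom_prod _ s _ _ h) => ->; move: sin; rewrite mem_partitions => /andP[_ /eqP <-].
by rewrite -big_distrl /= sumnE.
Qed.

Lemma ev_pleth P m e f g : hom e g ->
  ev iota P (m * e) (pleth m f g) =
  ev iota (fun k => ev iota (fun j => P (k * j)%N) e g) m f.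
Proof.
move=> hg; rewrite /ev /pleth.
under eq_bigr do rewrite rmorph_sum mulr_suml.
rewrite exchange_big /=; apply: eq_big_seq => s.
rewrite mem_partitions => /andP[ps /eqP ss].
under eq_bigr do rewrite rmorphM -mulrA.
rewrite -mulr_sumr; congr (_ * _).
have h k : hom (k * e) (adams k g) by apply: hom_adams.
transitivity (ev iota P (\sum_(k <- s) k * e)%N (prodf [seq adams k g | k <- s])).
  by rewrite -big_distrl /= -sumnE ss.
rewrite ev_prod //; apply: eq_big_seq => k ks.
by rewrite ev_adams // (partition_part_gt0 ps ks).
Qed.

End Eval.

(** * Complete symmetric functions and Newton's identities *)

Lemma hom_hsym m : hom m (hsym m).
Proof. by move=> r; rewrite /hsym; case: ifP => [/andP[/eqP ->]|_]; rewrite ?eqxx. Qed.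

Lemma hsymE m r : is_partition r -> sumn r = m -> hsym m r = (zee r)%:R^-1.
Proof. by rewrite /hsym => -> ->; rewrite eqxx. Qed.

Lemma zee1 k : zee [:: k] = k.
Proof. by rewrite zee_cons /zee /= big_nil !muln1. Qed.

Lemma sum_masks_size0 r (F : seq nat -> nat) :
  (\sum_(p <- masks r) (size p.1 == 0) * F p.1 = F [::])%N.
Proof.
elim: r => [|x r IH]; first by rewrite /masks /= big_seq1 mul1n.
by rewrite (big_masks_cons (R := nat)) -{}IH /= big1 // add0r.
Qed.

(** Summing over the ways to detach a single part recovers the size of [r]; this supplies the factor
    [m] in Newton's identity. *)
Lemma sum_masks_size1 r : (\sum_(p <- masks r) (size p.1 == 1) * sumn p.1 = sumn r)%N.
Proof.
elim: r => [|x r IH]; first by rewrite /masks /= big_seq1.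
rewrite (big_masks_cons (R := nat)) /= IH; congr (_ + _)%N.
by rewrite -[RHS]addn0; exact: (sum_masks_size0 r (fun s => x + sumn s)%N).
Qed.

Section Complete.
Variables (A : comNzRingType) (iota : {rmorphism algC -> A}).
Implicit Types P Q : nat -> A.

Definition hev P m := ev iota P m (hsym m).

Lemma hevE P m : hev P m = \sum_(r <- partitions m) iota (zee r)%:R^-1 * \prod_(j <- r) P j.
Proof.
apply: eq_big_seq => r; rewrite mem_partitions => /andP[pr /eqP sr].
by rewrite hsymE.
Qed.

Lemma hev0 P : hev P 0 = 1.
Proof. by rewrite hevE /partitions /= big_seq1 big_nil /zee big_nil invr1 rmorph1 mulr1. Qed.

(** The multiplicity z_r / (z_s z_t) of a splitting turns the weight 1/z_r into the product of 1/z_s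
    and 1/z_t. *)
Lemma hevD P Q m :
  hev (fun j => P j + Q j) m = \sum_(0 <= a < m.+1) hev P a * hev Q (m - a).
Proof.
transitivity (\sum_(0 <= a < m.+1) \sum_(s <- partitions a) \sum_(t <- partitions (m - a))
   (iota (zee s)%:R^-1 * \prod_(j <- s) P j) * (iota (zee t)%:R^-1 * \prod_(j <- t) Q j)).
  rewrite -(sum_splits _ (fun s t => (iota (zee s)%:R^-1 * \prod_(j <- s) P j) *
     (iota (zee t)%:R^-1 * \prod_(j <- t) Q j))) hevE.
  apply: eq_big_seq => r; rewrite mem_partitions => /andP[pr /eqP sr].
  rewrite (prodD_splits iota) // mulr_sumr; apply: eq_big_seq => p _.
  rewrite mulrA -rmorphM mulKf ?zee_partition // invfM rmorphM; ring.
apply: eq_bigr => a _; rewrite !hevE mulr_suml; apply: eq_bigr => s _.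
by rewrite mulr_sumr.
Qed.

(** The factor [m] is the size of [r], written as a sum over its detached parts; regrouping by the
    detached part [k] leaves a partition of [m - k]. *)
Lemma newton P m : m%:R * hev P m = \sum_(1 <= k < m.+1) P k * hev P (m - k).
Proof.
have one a : \sum_(s <- partitions a) (size s == 1%N)%:R * \prod_(j <- s) P j =
    (0 < a)%:R * P a.
  have [->|a0] := posnP a.
    by rewrite /partitions /= big_seq1 !mul0r.
  rewrite (bigD1_seq [:: a]) ?partitions_uniq //=; last first.
    by rewrite mem_partitions is_partition_cons a0 /= addn0 eqxx.
  rewrite big_seq1 big_seq_cond big1 ?addr0 // => s; rewrite mem_partitions.
  case/andP=> /andP[_]; case: s => [|x [|y s]] /=; rewrite ?mul0r //.
  by rewrite addn0 => /eqP ->; rewrite eqxx.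
transitivity (\sum_(0 <= a < m.+1) \sum_(s <- partitions a) \sum_(t <- partitions (m - a))
   ((size s == 1%N)%:R * \prod_(j <- s) P j) * (iota (zee t)%:R^-1 * \prod_(j <- t) P j)).
  rewrite -(sum_splits _ (fun s t => ((size s == 1%N)%:R * \prod_(j <- s) P j) *
     (iota (zee t)%:R^-1 * \prod_(j <- t) P j))) hevE mulr_sumr.
  apply: eq_big_seq => r; rewrite mem_partitions => /andP[pr /eqP sr].
  rewrite -{1}sr -sum_masks_size1 natr_sum mulr_suml.
  rewrite (sum_masks r (fun s t => ((size s == 1%N) * sumn s)%:R *
     (iota (zee r)%:R^-1 * \prod_(j <- r) P j))).
  apply: eq_big_seq => p pin.
  rewrite -(rmorph_nat iota) count_masks //.
  move: pin; rewrite mem_splits // => /and3P[p1 p2 pp].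
  rewrite -(perm_big _ pp) big_cat /=.
  case: eqP => [|_]; last by rewrite !mul0n !(mul0r, mulr0).
  case: (p.1) p1 => [|x [|y s]] //= px _.
  rewrite addn0 mul1n mul1r zee1 big_seq1 -(rmorph_nat iota).
  (* The detached part [x] has z equal to [x], which cancels the weight [sumn p.1]. *)
  have -> : iota (zee p.2)%:R^-1 = iota ((zee r)%:R / (x%:R * (zee p.2)%:R)) * iota x%:R * iota (zee r)%:R^-1.
    rewrite -!rmorphM; congr (iota _).
    have := zee_partition px; rewrite zee1 => x0.
    by field; rewrite x0 !zee_partition.
  ring.
rewrite big_ltn // [X in X + _]big1_seq ?add0r; last first.
  move=> s /andP[_]; rewrite /partitions /= inE => /eqP ->.
  by rewrite big1 // => t _; rewrite !mul0r.
apply: eq_big_nat => a /andP[a0 am].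
transitivity (\sum_(s <- partitions a) ((size s == 1%N)%:R * \prod_(j <- s) P j) * hev P (m - a)).
  by apply: eq_bigr => s _; rewrite hevE mulr_sumr.
by rewrite -mulr_suml one a0 mul1r.
Qed.

Lemma sgn_prod r : is_partition r ->
  \prod_(j <- r) (-1 : A) ^+ j.-1 = (-1) ^+ (sumn r - size r).
Proof.
move/is_partition_gt0; elim: r => [|x r IH] /=; first by rewrite big_nil.
case/andP=> x0 ar; rewrite big_cons IH // -exprD; congr (_ ^+ _).
have : (size r <= sumn r)%N.
  by elim: r ar {IH} => //= y r IH /andP[y0 /IH]; lia.
lia.
Qed.

Lemma ev_esym P m :
  ev iota P m (Defs.esym m) = hev (fun j => (-1) ^+ j.-1 * P j) m.
Proof.
rewrite hevE; apply: eq_big_seq => r; rewrite mem_partitions => /andP[pr /eqP sr].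
rewrite /Defs.esym sr eqxx pr /= rmorphM rmorph_sign big_split /= sgn_prod // sr; ring.
Qed.

End Complete.

(** * Two one-variable specializations *)

Notation hevC := (@hev algC idfun).

(** This is e_m of the single variable 1. By induction, Newton's identity in degree [m.+2] keeps
    only the terms [k = m.+1] and [k = m.+2], which have opposite signs. *)
Lemma hev_sgn m : hevC (fun j => (-1) ^+ j.-1) m = (m <= 1)%:R.
Proof.
have [n] := ubnP m; elim: n m => // n IH [|[|m]] lmn.
- by rewrite hev0.
- by have := newton idfun (fun j => (-1) ^+ j.-1) 1; rewrite mul1r big_nat1 subnn hev0 mulr1.
apply/eqP; have := newton idfun (fun j => (-1) ^+ j.-1) m.+2.
rewrite 2?big_nat_recr //= (subnn m.+2) (_ : m.+2 - m.+1 = 1)%N; last by lia.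
have h1 : (1 < n)%N by lia.
rewrite (IH _ h1) (IH _ (ltnW h1)) /=.
rewrite big_nat big1 ?add0r; last first.
  move=> k /andP[k0 km]; rewrite IH; last by lia.
  by rewrite (_ : (m.+2 - k <= 1)%N = false) ?mulr0 //; lia.
rewrite exprS !mulr1 mulN1r subrr => /eqP; rewrite mulf_eq0 pnatr_eq0 /=.
by [].
Qed.

Lemma hev1 m : hevC (fun=> 1) m = 1.
Proof.
have [n] := ubnP m; elim: n m => // n IH [|m] lmn; first by rewrite hev0.
have := newton idfun (fun=> 1) m.+1.
rewrite big_add1 /= (eq_big_nat _ _ (F2 := fun=> 1)); last first.
  by move=> k km; rewrite mul1r IH //; lia.
rewrite big_const_nat subn0 iter_addr_0 => /eqP; rewrite -subr_eq0 -[X in _ - X]mulr1 -mulrBr.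
by rewrite mulf_eq0 pnatr_eq0 /= subr_eq0 => /eqP.
Qed.

(** * Splitting off a variable and Schur coefficients *)

Lemma partition_part_le d r j : is_partition r -> (sumn r <= d)%N -> j \in r -> (j <= d)%N.
Proof.
move=> _; elim: r => //= x r IH h; rewrite inE => /orP[/eqP ->|jr]; first lia.
by apply: IH jr; lia.
Qed.

(** Independent variables for the p_j with [j <= d]: in degree at most [d] distinct partitions give
    distinct monomials [mon d r], so coefficients can be read off. *)
Definition gen (d j : nat) : {mpoly algC[d.+1]} := 'X_(inord j).
Definition mpC (d : nat) : {rmorphism algC -> {mpoly algC[d.+1]}} := @mpolyC d.+1 algC.
Definition mon (d : nat) (r : seq nat) : 'X_{1..d.+1} := (\sum_(j <- r) U_(inord j))%MM.

Lemma prod_gen d r : \prod_(j <- r) gen d j = 'X_[mon d r].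
Proof.
elim: r => [|x r IH]; first by rewrite /mon !big_nil mpolyX0.
by rewrite /mon !big_cons mpolyXD IH.
Qed.

Lemma mon_count d r j : (j <= d)%N -> all (geq d) r -> mon d r (inord j) = count_mem j r.
Proof.
move=> jd; elim: r => [|x r IH] /=; first by rewrite /mon big_nil mnm0E.
case/andP=> xd ar; rewrite /mon big_cons mnmDE -/(mon d r) IH // mnm1E.
by rewrite -val_eqE /= !inordK.
Qed.

Lemma mon_inj d r s : is_partition r -> is_partition s -> (sumn r <= d)%N ->
  (sumn s <= d)%N -> mon d r = mon d s -> r = s.
Proof.
move=> pr ps sr ss e.
have ar : all (geq d) r by apply/allP => x; apply: partition_part_le.
have as_ : all (geq d) s by apply/allP => x; apply: partition_part_le.
apply: partition_eqP => //; apply/allP => x _ /=.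
have [xd|xd] := leqP x d; first by rewrite -!(@mon_count d) // e.
rewrite !(count_memPn _) //; first by apply/negP => /(allP as_) /=; lia.
by apply/negP => /(allP ar) /=; lia.
Qed.

(** * The Hall pairing and the adjoint of multiplication by h_k *)

Definition hall (d : nat) (f g : symf) : algC :=
  \sum_(r <- partitions d) (zee r)%:R * f r * g r.

(* p_j is evaluated at t^j + q_j, i.e. one variable t is split off; the
   coefficient of t^k is then the image of h_k^\perp f. *)
Definition tev (B : comNzRingType) (iota : {rmorphism algC -> B}) (Q : nat -> B)
    (d : nat) (f : symf) : {poly B} :=
  ev (polyC \o iota) (fun j => 'X^j + (Q j)%:P) d f.

Lemma prodXn (B : comNzRingType) r : \prod_(j <- r) ('X^j : {poly B}) = 'X^(sumn r).
Proof. by elim: r => [|x r IH]; rewrite ?big_nil ?big_cons //= IH exprD. Qed.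

Lemma coef_tev (B : comNzRingType) (iota : {rmorphism algC -> B}) Q d f k :
  (tev iota Q d f)`_k = \sum_(r <- partitions d) \sum_(p <- splits r | sumn p.1 == k)
    iota (f r * ((zee r)%:R / ((zee p.1)%:R * (zee p.2)%:R))) * \prod_(j <- p.2) Q j.
Proof.
rewrite /tev /ev coef_sum; apply: eq_big_seq => r.
rewrite mem_partitions => /andP[pr _].
rewrite (prodD_splits (polyC \o iota)) // coefCM coef_sum mulr_sumr [RHS]big_mkcond /=.
apply: eq_bigr => p _.
rewrite coefCM prodXn -(rmorph_prod polyC) coefMC coefXn eq_sym rmorphM.
case: eqP => _; last by rewrite mul0r !mulr0.
by rewrite mul1r !rmorphM !mulrA.
Qed.

(** The Hall pairing with [g] in degree [e], for a symmetric function given as a polynomial in the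
    power sums. *)
Definition pairfun d e (g : symf) (q : {mpoly algC[d.+1]}) : algC :=
  \sum_(t <- partitions e) q@_(mon d t) * ((zee t)%:R * g t).

Lemma pairfun_sum d e g I (s : seq I) (P : pred I) F :
  pairfun e g (\sum_(i <- s | P i) F i) = \sum_(i <- s | P i) @pairfun d e g (F i).
Proof.
rewrite /pairfun exchange_big; apply: eq_bigr => t _.
by rewrite raddf_sum mulr_suml.
Qed.

Lemma pairfunX d e g c t : (e <= d)%N -> t \in partitions e ->
  pairfun e g (mpolyC d.+1 c * 'X_[mon d t]) = c * ((zee t)%:R * g t).
Proof.
move=> ed te; rewrite /pairfun (bigD1_seq t te (partitions_uniq e)) /=.
rewrite mcoeffCM mcoeffX eqxx mulr1 big_seq_cond big1 ?addr0 // => t' /andP[t'e t't].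
rewrite mcoeffCM mcoeffX; case: eqP => [/mon_inj h|_]; last by rewrite mulr0 mul0r.
move: te t'e; rewrite !mem_partitions => /andP[pt /eqP st] /andP[pt' /eqP st'].
by rewrite h ?eqxx ?st ?st' in t't.
Qed.

(** In the coefficient of t^k the splittings [p] with [p.1] of size [k] survive. Their multiplicity
    z_r / (z_s z_t), times z_t from the pairing, leaves z_r / z_s, and 1/z_s is the coefficient of
    h_k. *)
Lemma hall_hsym_mul d f g k :
  hall d f (mulf (hsym k) g) = pairfun (d - k) g (tev (mpC d) (gen d) d f)`_k.
Proof.
rewrite coef_tev pairfun_sum; apply: eq_big_seq => r.
rewrite mem_partitions => /andP[pr /eqP sr].
rewrite /mulf mulr_sumr pairfun_sum [RHS]big_mkcond.
apply: eq_big_seq => p pin; have sp := sumn_splits pin.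
move: pin; rewrite mem_splits // => /and3P[p1 p2 pp].
case: eqP => [e|ne]; last first.
  by rewrite /hsym; case: eqP ne => //= _ _; rewrite mul0r mulr0.
rewrite hsymE // prod_gen pairfunX; last 2 first.
- lia.
- by rewrite mem_partitions p2 -sr -sp e addKn /=.
by field; rewrite !zee_partition.
Qed.

(** The generic ring [{mpoly algC[d.+1]}] depends on the degree, so the bound is demanded in every
    target ring; this makes it pass to products. *)
Definition tbounded (d N : nat) (f : symf) : Prop :=
  hom d f /\ forall (B : comNzRingType) (iota : {rmorphism algC -> B}) (Q : nat -> B),
    (size (tev iota Q d f) <= N.+1)%N.

Lemma hall_bounded d e N f g k : tbounded d N f -> (N < k)%N ->
  hall e f (mulf (hsym k) g) = 0.
Proof.
case=> hf tf Nk; have [ed|ed] := eqVneq e d; last first.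
  rewrite /hall big_seq big1 // => r; rewrite mem_partitions => /andP[_ /eqP sr].
  have [->|/hf fr] := eqVneq (f r) 0; first by rewrite mulr0 mul0r.
  by rewrite -sr fr eqxx in ed.
rewrite hall_hsym_mul nth_default.
  by rewrite /pairfun big1 // => t _; rewrite mcoeff0 mul0r.
by rewrite ed; apply: leq_trans (tf _ _ _) Nk.
Qed.

(** * Expansion of the Jacobi-Trudi determinant along its first row *)

Section JacobiTrudi.
Variables (f : symf) (a : nat) (l : seq nat).
Implicit Type s : 'S_(size l).+1.

Let rest s := prodf [seq jt (a :: l) (val (lift ord0 i)) (val (s (lift ord0 i)))
   | i : 'I_(size l) <- enum 'I_(size l)].

Lemma scoef_cons : scoef f (a :: l) =
  \sum_(s : 'S_(size l).+1) (-1) ^+ s * hall (a + sumn l) f (mulf (hsym (a + s ord0)) (rest s)).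
Proof.
rewrite /scoef; transitivity (\sum_(r <- partitions (a + sumn l)) \sum_(s : 'S_(size l).+1)
  (-1) ^+ s * ((zee r)%:R * f r * mulf (hsym (a + s ord0)) (rest s) r)).
  apply: eq_bigr => r _; rewrite /schur mulr_sumr; apply: eq_bigr => s _.
  rewrite enum_ordSl /= -map_comp /jt /= subn0.
  by rewrite mulrCA.
by rewrite exchange_big; apply: eq_bigr => s _; rewrite mulr_sumr.
Qed.

Lemma hom_jt i j : hom (nth 0%N (a :: l) i + j - i) (jt (a :: l) i j).
Proof. by rewrite /jt; case: ifP => _; [move=> r; rewrite eqxx | exact: hom_hsym]. Qed.

Definition jtev (P : nat -> algC) (i j : nat) : algC :=
  if (nth 0%N (a :: l) i + j < i)%N then 0 else hevC P (nth 0%N (a :: l) i + j - i).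

Lemma ev_jt P i j : ev idfun P (nth 0%N (a :: l) i + j - i) (jt (a :: l) i j) = jtev P i j.
Proof.
rewrite /jt /jtev; case: ifP => // _.
by rewrite /ev big1 // => r _; rewrite /= mul0r.
Qed.

Lemma prodf_zero (T : eqType) (s : seq T) (F : T -> symf) x r :
  x \in s -> F x =1 zerof -> prodf [seq F i | i <- s] r = 0.
Proof.
move=> + Fx; elim: s r => //= y s IH r; rewrite inE => /orP[/eqP <-|/IH h].
  by rewrite /mulf big1 // => p _; rewrite Fx mul0r.
by rewrite /mulf big1 // => p _; rewrite h mulr0.
Qed.

(** If some index is negative, both sides vanish. Otherwise the degrees of the factors add up to
    [sumn l], because [s] permutes the nonzero indices and the shifts cancel. *)
Lemma ev_rest (P : nat -> algC) s : s ord0 = ord0 ->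
  ev idfun P (sumn l) (rest s) =
  \prod_(i < size l) jtev P (lift ord0 i) (s (lift ord0 i)).
Proof.
move=> s0; pose D (i : 'I_(size l)) :=
  (nth 0%N (a :: l) (lift ord0 i) + s (lift ord0 i) - lift ord0 i)%N.
have [/existsP[i ilt]|/existsPn nlt] := boolP [exists i : 'I_(size l),
    (nth 0%N (a :: l) (lift ord0 i) + s (lift ord0 i) < lift ord0 i)%N].
  rewrite (bigD1 i) //= /jtev ilt mul0r /ev big1 // => r _.
  rewrite /rest (@prodf_zero _ _ _ i) ?mem_enum ?mul0r //.
  by move=> r'; rewrite /jt ilt.
have -> : sumn l = (\sum_(i <- enum 'I_(size l)) D i)%N.
  rewrite big_enum /= sumnB; last by move=> i _; rewrite leqNgt.
  rewrite big_split /=.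
  have <- : (\sum_(i < size l) s (lift ord0 i) = \sum_(i < size l) lift ord0 i)%N.
    have : (\sum_(i < (size l).+1) s i = \sum_(i < (size l).+1) i)%N.
      by rewrite [RHS](reindex_inj (@perm_inj _ s)).
    by rewrite !big_ord_recl s0 /= !add0n => ->.
  by rewrite addnK sumnE (big_nth 0%N) big_mkord.
rewrite ev_prod => [|i]; last exact: hom_jt.
by rewrite big_enum; apply: eq_bigr => i _; exact: ev_jt.
Qed.

(** In the first row every h_k with [k > a] pairs to zero, so only [s ord0 = ord0] survives and the
    row becomes (1, 0, ..., 0). The other rows are specialized at [P]. *)
Lemma scoef_top d (P : nat -> algC) : tbounded d a f ->
  (forall g, hall (a + sumn l) f (mulf (hsym a) g) = ev idfun P (sumn l) g) ->
  scoef f (a :: l) = \det (\matrix_(i < (size l).+1, j < (size l).+1)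
    if i == ord0 then (j == ord0)%:R else jtev P i j).
Proof.
move=> tf topf; rewrite scoef_cons; apply: eq_bigr => s _.
congr (_ * _); rewrite big_ord_recl mxE eqxx.
have [s0|s0] := eqVneq (s ord0) ord0; last first.
  rewrite mul0r (@hall_bounded d _ a) //.
  by rewrite -[X in (X < _)%N]addn0 ltn_add2l lt0n.
rewrite s0 addn0 topf ev_rest // mul1r; apply: eq_bigr => i _.
by rewrite mxE.
Qed.

End JacobiTrudi.

Lemma tbounded_bounded d N f : tbounded d N f -> bounded f N.
Proof.
move=> tf [|a l] // _; apply: contraNT; rewrite -ltnNge /= => Na.
rewrite scoef_cons big1 // => s _.
by rewrite (hall_bounded _ _ tf) ?mulr0 //; lia.
Qed.

(** Here [c] is the leading coefficient in t. If its p_r-coefficient is the product of the [P j]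
    divided by z_r, pairing with [c] is the specialization of p_j to [P j]: all ones for h_n, signs
    (-1)^(j-1) for e_n. *)
Lemma hall_top d N f c g (P : nat -> algC) : (N <= d)%N ->
  (tev (mpC d) (gen d) d f)`_N = ev (mpC d) (gen d) (d - N) c ->
  (forall r, is_partition r -> sumn r = (d - N)%N -> c r * (zee r)%:R = \prod_(j <- r) P j) ->
  hall d f (mulf (hsym N) g) = ev idfun P (d - N) g.
Proof.
move=> Nd tN cP; rewrite hall_hsym_mul tN pairfun_sum; apply: eq_big_seq => r rin.
rewrite prod_gen pairfunX //; last by lia.
move: rin; rewrite mem_partitions => /andP[pr /eqP sr].
by rewrite mulrA cP //= mulrC.
Qed.

(** * Degree bounds for plethysms *)

Lemma size_sum_le (B : comNzRingType) I (r : seq I) (P : pred I) (F : I -> {poly B}) n :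
  (forall i, P i -> (size (F i) <= n)%N) -> (size (\sum_(i <- r | P i) F i)%R <= n)%N.
Proof.
move=> h; elim/big_ind: _ => // [|p q hp hq]; first by rewrite size_poly0.
by apply: leq_trans (size_polyD _ _) _; rewrite geq_max hp.
Qed.

Lemma size_polyM_le (B : comNzRingType) (p q : {poly B}) a b :
  (size p <= a.+1)%N -> (size q <= b.+1)%N -> (size (p * q)%R <= (a + b).+1)%N.
Proof.
move=> sp sq; apply: leq_trans (size_polyMleq _ _) _.
by rewrite -subn1 leq_subLR add1n -addnS -addSn; exact: leq_add.
Qed.

Lemma tbounded_mul a b N M f g : tbounded a N f -> tbounded b M g ->
  tbounded (a + b) (N + M) (mulf f g).
Proof.
move=> [hf tf] [hg tg]; split=> [|B iota Q]; first exact: hom_mul.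
by rewrite /tev ev_mul //; apply: size_polyM_le; [exact: tf | exact: tg].
Qed.

Lemma tbounded_one : tbounded 0 0 onef.
Proof. by split=> [|B iota Q]; [exact: hom_one | rewrite /tev ev_one size_poly1]. Qed.

Lemma tbounded_prod (T : eqType) (s : seq T) (D N : T -> nat) (F : T -> symf) :
  (forall i, i \in s -> tbounded (D i) (N i) (F i)) ->
  tbounded (\sum_(i <- s) D i) (\sum_(i <- s) N i) (prodf [seq F i | i <- s]).
Proof.
elim: s => [|i s IH] h; first by rewrite !big_nil; exact: tbounded_one.
rewrite !big_cons; apply: tbounded_mul; first by apply: h; rewrite mem_head.
by apply: IH => j js; apply: h; rewrite inE js orbT.
Qed.

Lemma tbounded_le d N M f : (N <= M)%N -> tbounded d N f -> tbounded d M f.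
Proof. by move=> NM [hf tf]; split=> // B iota Q; apply: leq_trans (tf _ _ _) _. Qed.

Lemma coefM_top (B : comNzRingType) (p q : {poly B}) a b :
  (size p <= a.+1)%N -> (size q <= b.+1)%N -> (p * q)`_(a + b) = p`_a * q`_b.
Proof.
move=> sp sq; have aab : (a < (a + b).+1)%N by lia.
rewrite coefM (bigD1 (Ordinal aab)) //= addKn big1 ?addr0 // => i /eqP ia.
have [ai|ia'] := ltnP a i; first by rewrite nth_default ?mul0r // (leq_trans sp).
rewrite [X in _ * X]nth_default ?mulr0 //; apply: leq_trans sq _.
have : (i : nat) != a by apply/eqP => e; apply: ia; apply: val_inj.
by move: ia' (ltn_ord i) => /=; lia.
Qed.

Lemma prod_top (B : comNzRingType) c (A : nat -> {poly B}) (s : seq nat) :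
  (forall k, k \in s -> (size (A k) <= (k * c).+1)%N) ->
  (size (\prod_(k <- s) A k)%R <= (sumn s * c).+1)%N /\
  (\prod_(k <- s) A k)`_(sumn s * c) = \prod_(k <- s) (A k)`_(k * c).
Proof.
elim: s => [|k s IH] h; first by rewrite !big_nil mul0n coef1 size_poly1.
have /IH[s1 s2] : forall k, k \in s -> (size (A k) <= (k * c).+1)%N.
  by move=> j js; apply: h; rewrite inE js orbT.
have hk := h _ (mem_head _ _).
rewrite !big_cons /= mulnDl coefM_top // s2; split=> //.
exact: size_polyM_le.
Qed.

(** Along a partition of [m] the degree bounds [k * c] add up to [m * c], so leading coefficients
    multiply and the leading coefficient of the value is the value at the leading coefficients. *)
Lemma ev_top (B : comNzRingType) (iota : {rmorphism algC -> B}) c (A : nat -> {poly B}) m f :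
  (forall k, (0 < k)%N -> (size (A k) <= (k * c).+1)%N) ->
  (size (ev (polyC \o iota) A m f) <= (m * c).+1)%N /\
  (ev (polyC \o iota) A m f)`_(m * c) = ev iota (fun k => (A k)`_(k * c)) m f.
Proof.
move=> hA; have h r : r \in partitions m ->
    (size (\prod_(k <- r) A k)%R <= (m * c).+1)%N /\
    (\prod_(k <- r) A k)`_(m * c) = \prod_(k <- r) (A k)`_(k * c).
  rewrite mem_partitions => /andP[pr /eqP <-]; apply: prod_top => k kr.
  exact/hA/partition_part_gt0/kr.
split.
  rewrite /ev big_seq; apply: size_sum_le => r rin /=.
  by rewrite mul_polyC; apply: leq_trans (size_scale_leq _ _) (h _ rin).1.
by rewrite /ev coef_sum; apply: eq_big_seq => r rin; rewrite coefCM (h _ rin).2.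
Qed.

(** The image of p_k[p_j] after splitting off t. *)
Definition dil (B : comNzRingType) (Q : nat -> B) k j : {poly B} := 'X^(k * j) + (Q (k * j)%N)%:P.

Lemma tev_pleth (B : comNzRingType) (iota : {rmorphism algC -> B}) Q m n f g : hom n g ->
  tev iota Q (m * n) (pleth m f g) =
  ev (polyC \o iota) (fun k => ev (polyC \o iota) (dil Q k) n g) m f.
Proof. by move=> hg; rewrite /tev ev_pleth. Qed.

(** Once the pure power of t is removed, every term omits the power of t of some factor and so loses
    at least [k] in degree. *)
Lemma size_prod_dil (B : comNzRingType) (Q : nat -> B) k r : is_partition r ->
  (size (\prod_(j <- r) dil Q k j - 'X^(k * sumn r))%R <= (k * (sumn r - 1)).+1)%N.
Proof.
move/is_partition_gt0; elim: r => [|j r IH] /=.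
  by rewrite big_nil muln0 subrr size_poly0.
case/andP=> j0 ar; rewrite big_cons; set p := \prod_(_ <- r) _.
have -> : dil Q k j * p - 'X^(k * (j + sumn r)) =
    'X^(k * j) * (p - 'X^(k * sumn r)) + (Q (k * j)%N)%:P * p.
  by rewrite mulnDr exprD /dil; ring.
(* For empty [r] the subtraction [sumn r - 1] truncates, and the induction bound would be too weak
   by [k]. *)
have [r0|r0] := eqVneq r [::].
  rewrite /p r0 big_nil muln0 expr0 subrr mulr0 add0r mulr1.
  by apply: leq_trans (size_polyC_leq1 _) _.
have sr0 : (0 < sumn r)%N by case: (r) ar r0 => //= x s /andP[x0 _] _; lia.
have {}IH := IH ar.
have ps : (size p <= (k * sumn r).+1)%N.
  rewrite -(subrK 'X^(k * sumn r) p).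
  apply: leq_trans (size_polyD _ _) _; rewrite geq_max size_polyXn leqnn andbT.
  by apply: leq_trans IH _; rewrite ltnS leq_mul2l leq_subr orbT.
apply: leq_trans (size_polyD _ _) _; rewrite geq_max; apply/andP; split.
  apply: leq_trans (size_polyMleq _ _) _; rewrite size_polyXn /=.
  apply: (@leq_trans (k * j + (k * (sumn r - 1)).+1)%N); first by rewrite leq_add2l.
  by rewrite addnS -mulnDr ltnS leq_mul2l; lia.
rewrite mul_polyC; apply: leq_trans (size_scale_leq _ _) _.
by apply: leq_trans ps _; rewrite ltnS leq_mul2l; lia.
Qed.

(** The hypothesis says that [g] pairs to zero with h_n. The total coefficient of the pure powers
    t^(kn) is this sum, so subtracting t^(kn) from each product changes nothing. *)
Lemma size_ev_dil (B : comNzRingType) (iota : {rmorphism algC -> B}) Q n g k :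
  \sum_(r <- partitions n) g r = 0 ->
  (size (ev (polyC \o iota) (dil Q k) n g) <= (k * (n - 1)).+1)%N.
Proof.
move=> g0.
have -> : ev (polyC \o iota) (dil Q k) n g = \sum_(r <- partitions n)
    (polyC \o iota) (g r) * (\prod_(j <- r) dil Q k j - 'X^(k * n)).
  under [RHS]eq_bigr do rewrite mulrBr.
  by rewrite sumrB -mulr_suml -rmorph_sum g0 rmorph0 mul0r subr0.
rewrite big_seq; apply: size_sum_le => r.
rewrite mem_partitions => /andP[pr /eqP <-] /=.
by rewrite mul_polyC; apply: leq_trans (size_scale_leq _ _) (size_prod_dil _ _ pr).
Qed.

Lemma tbounded_pleth m n f g : hom n g -> \sum_(r <- partitions n) g r = 0 ->
  tbounded (m * n) (m * (n - 1)) (pleth m f g).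
Proof.
move=> hg g0; split=> [|B iota Q]; first exact: hom_pleth.
rewrite tev_pleth //.
by apply: (ev_top _ _ _ _).1 => k _; apply: size_ev_dil.
Qed.

(** * Plethysms with e_2 and h_2 *)

Section DegreeTwo.
Variables (B : comNzRingType) (iota : {rmorphism algC -> B}) (Q : nat -> B).

Definition half : B := iota 2%:R^-1.
Lemma half2 : half + half = 1.
Proof. by rewrite /half -rmorphD -(rmorph1 iota); congr (iota _); field. Qed.

Lemma partitions2 : partitions 2 = [:: [:: 1; 1]; [:: 2]]%N.
Proof. by []. Qed.

(** The two halves of t^(2k), from p_1^2 and from p_2, cancel here; for h_2 below they add up. *)
Lemma ev_dil_e2 g k : g [:: 1; 1]%N = 2%:R^-1 -> g [:: 2]%N = - 2%:R^-1 ->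
  ev (polyC \o iota) (dil Q k) 2 g =
  'X^k * (Q k)%:P + (half * (Q k ^+ 2 - Q (k * 2)%N))%:P.
Proof.
move=> g1 g2; rewrite /ev partitions2 !big_cons !big_nil g1 g2 rmorphN /dil !muln1 /=.
rewrite -/half muln2 -addnn exprD polyCM polyCB polyC_exp.
have : half%:P + half%:P = 1 :> {poly B} by rewrite -polyCD half2.
move: half%:P => h h2.
rewrite [RHS](_ : _ = (h + h) * ('X^k * (Q k)%:P) + h * ((Q k)%:P ^+ 2 - (Q (k + k)%N)%:P)).
  ring.
by rewrite h2 mul1r.
Qed.

Lemma ev_dil_h2 g k : g [:: 1; 1]%N = 2%:R^-1 -> g [:: 2]%N = 2%:R^-1 ->
  ev (polyC \o iota) (dil Q k) 2 g =
  'X^2 ^+ k + ('X^k * (Q k)%:P + (half * (Q k ^+ 2 + Q (k * 2)%N))%:P).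
Proof.
move=> g1 g2; rewrite /ev partitions2 !big_cons !big_nil g1 g2 /dil !muln1 /=.
rewrite -/half muln2 -addnn exprD polyCM polyCD polyC_exp -exprM mul2n -addnn exprD.
have : half%:P + half%:P = 1 :> {poly B} by rewrite -polyCD half2.
move: half%:P => h h2.
rewrite [RHS](_ : _ = (h + h) * ('X^k * 'X^k + 'X^k * (Q k)%:P) + h * ((Q k)%:P ^+ 2 + (Q (k + k)%N)%:P)).
  ring.
by rewrite h2 mul1r addrA.
Qed.

Lemma size_linear k u : (size ('X^k * (Q k)%:P + u%:P)%R <= (k * 1).+1)%N.
Proof.
rewrite muln1; apply: leq_trans (size_polyD _ _) _; rewrite geq_max; apply/andP; split.
  rewrite mulrC mul_polyC; apply: leq_trans (size_scale_leq _ _) _.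
  by rewrite size_polyXn.
exact: leq_trans (size_polyC_leq1 _) _.
Qed.

Lemma coef_linear k u : (0 < k)%N -> ('X^k * (Q k)%:P + u%:P)%R`_(k * 1) = Q k.
Proof.
by move=> k0; rewrite muln1 coefD coefMC coefXn eqxx mul1r coefC -[k == 0]negbK -lt0n k0 addr0.
Qed.

(** The leading term of p_k[e_2[X + t]] is t^k p_k, so the leading coefficient of h_m[e_2] is h_m
    itself. *)
Lemma coef_tev_he2 m g : hom 2 g -> g [:: 1; 1]%N = 2%:R^-1 -> g [:: 2]%N = - 2%:R^-1 ->
  (tev iota Q (m * 2) (hpl m g))`_m = ev iota Q m (hsym m).
Proof.
move=> hg g1 g2; rewrite /hpl tev_pleth //.
have [|_] := @ev_top _ iota 1 (fun k => ev (polyC \o iota) (dil Q k) 2 g) m (hsym m).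
  by move=> k _; rewrite ev_dil_e2 // size_linear.
rewrite muln1 => ->.
by apply: ev_ext => // j /andP[j0 _]; rewrite ev_dil_e2 // coef_linear.
Qed.

Lemma hev_homog (A : comNzRingType) (i : {rmorphism algC -> A}) (P : nat -> A) u m :
  hev i (fun j => u ^+ j * P j) m = u ^+ m * hev i P m.
Proof.
rewrite !hevE mulr_sumr; apply: eq_big_seq => r; rewrite mem_partitions => /andP[_ /eqP <-].
rewrite big_split /=; have -> : \prod_(j <- r) u ^+ j = u ^+ sumn r.
  by elim: r => [|x r IH]; rewrite ?big_nil ?big_cons //= IH exprD.
ring.
Qed.

Lemma hev_rmorph (A : comNzRingType) (i : {rmorphism algC -> A}) (P : nat -> algC) m :
  hev i (fun j => i (P j)) m = i (hevC P m).
Proof.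
rewrite !hevE rmorph_sum; apply: eq_bigr => r _.
by rewrite rmorphM; congr (_ * _); rewrite rmorph_prod.
Qed.

(** With h_2[X + t] = t^2 + C, the addition formula expands e_m[t^2 + C] into products of e_a[t^2]
    and e_(m-a)[C]. Only [a = 0], of degree at most [m], and [a = 1], of degree at most 2 + (m - 1),
    remain; the latter gives the leading coefficient. *)
Lemma tev_eh2 m g : hom 2 g -> g [:: 1; 1]%N = 2%:R^-1 -> g [:: 2]%N = 2%:R^-1 ->
  (size (tev iota Q (m * 2) (epl m g)) <= m.+2)%N /\
  ((0 < m)%N -> (tev iota Q (m * 2) (epl m g))`_m.+1 = ev iota Q m.-1 (Defs.esym m.-1)).
Proof.
move=> hg g1 g2; rewrite /epl tev_pleth // ev_esym.
pose C k := 'X^k * (Q k)%:P + (half * (Q k ^+ 2 + Q (k * 2)%N))%:P.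
have hC n f : (size (ev (polyC \o iota) C n f) <= n.+1)%N /\
    (ev (polyC \o iota) C n f)`_n = ev iota Q n f.
  have [|s1 s2] := @ev_top _ iota 1 C n f; first by move=> k _; apply: size_linear.
  rewrite muln1 in s1 s2; split; first exact: s1.
  by rewrite s2; apply: ev_ext => // j /andP[j0 _]; apply: coef_linear.
set E := hev _ _ _.
have -> : E = \sum_(0 <= a < m.+1) (a <= 1)%:R * 'X^2 ^+ a * ev (polyC \o iota) C (m - a) (Defs.esym (m - a)).
  (* Writing e_m as h_m at signed power sums makes [hevD] applicable; the part from t^2 is then
     evaluated by [hev_homog] and [hev_sgn]. *)
  transitivity (hev (polyC \o iota) (fun j => 'X^2 ^+ j * (polyC \o iota) ((-1) ^+ j.-1) + (-1) ^+ j.-1 * C j) m).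
    apply: ev_ext => // j _; rewrite ev_dil_h2 // mulrDr rmorph_sign -/(C j).
    by rewrite [in LHS]mulrC.
  rewrite hevD; apply: eq_bigr => a _; rewrite hev_homog hev_rmorph hev_sgn rmorph_nat ev_esym.
  by rewrite [_%:R * _]mulrC.
case: m {E} => [|m].
  rewrite big_nat1 !mul1r; split=> //.
  by apply: leq_trans (hC _ _).1 _.
rewrite !big_nat_recl // big_nat big1 ?addr0; last by move=> i _; rewrite !mul0r.
rewrite !mul1r !subn0 subSS subn0 expr1 /=; split.
  apply: leq_trans (size_polyD _ _) _; rewrite geq_max; apply/andP; split.
    by apply: leq_trans (hC _ _).1 _.
  by apply: (@size_polyM_le _ _ _ 2); [rewrite size_polyXn | exact: (hC _ _).1].
move=> _; rewrite coefD nth_default ?add0r; last exact: (hC _ _).1.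
by rewrite coefXnM /= !subSS subn0 (hC _ _).2.
Qed.

End DegreeTwo.

(** * The characteristics ell_n and pi_n *)

Section CycleType.
Variable n : nat.
Implicit Type s : 'S_n.

Lemma sumn_ctype s : sumn (ctype s) = n.
Proof.
rewrite /ctype (perm_sumn (permEl (perm_sort _ _))).
rewrite sumnE big_map big_enum /=.
rewrite -[RHS]card_ord -sum1_card (partition_big_imset (porbit s)) /=.
apply: eq_bigr => X /imsetP[y _ ->]; rewrite -sum1_card.
by apply: eq_bigl => x; rewrite eq_porbit_mem.
Qed.

Lemma ctype_partition s : is_partition (ctype s).
Proof.
apply: is_partition_sort; apply/allP => x /mapP[X]; rewrite mem_enum => /imsetP[y _ ->] ->.
by apply/card_gt0P; exists y; exact: porbit_id.
Qed.

Lemma size_ctype s : size (ctype s) = #|porbits s|.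
Proof. by rewrite size_sort size_map cardE. Qed.

Lemma sign_ctype s : (-1) ^+ s = (-1) ^+ (n - size (ctype s)) :> algC.
Proof.
have le : (size (ctype s) <= n)%N.
  rewrite -{2}(sumn_ctype s); move/is_partition_gt0: (ctype_partition s).
  by elim: (ctype s) => //= x r IH /andP[x0 /IH]; lia.
by rewrite -[RHS]signr_odd oddB // size_ctype /odd_perm card_ord.
Qed.

Lemma sum_ctype (F : seq nat -> 'S_n -> algC) :
  \sum_(r <- partitions n) \sum_(s : 'S_n | ctype s == r) F r s = \sum_s F (ctype s) s.
Proof.
under eq_bigr do rewrite big_mkcond.
rewrite exchange_big; apply: eq_bigr => s _.
rewrite (bigD1_seq (ctype s)) ?partitions_uniq //=; last first.
  by rewrite mem_partitions ctype_partition sumn_ctype /=.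
by rewrite eqxx big1 ?addr0 // => r; rewrite eq_sym => /negPf ->.
Qed.

End CycleType.

Lemma hom_ell n : hom n (ell n).
Proof.
move=> r; rewrite /ell /frob; apply: contraNeq => nr; apply/eqP.
rewrite big1 ?mulr0 // => s /eqP es.
by rewrite -es sumn_ctype eqxx in nr.
Qed.

Lemma hom_pi n : hom n (pi_ n).
Proof.
by move=> r; rewrite /pi_ /omega mulf_eq0 negb_or => /andP[_]; apply: hom_ell.
Qed.

Lemma sum_ell n : \sum_(r <- partitions n) ell n r = n`!%:R^-1 * \sum_s LieChar n s.
Proof. by rewrite /ell /frob -mulr_sumr sum_ctype. Qed.

Lemma sum_pi n : \sum_(r <- partitions n) pi_ n r =
  n`!%:R^-1 * \sum_(s : 'S_n) (-1) ^+ s * LieChar n s.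
Proof.
rewrite /pi_ /omega /ell /frob; under eq_bigr do rewrite mulrCA mulr_sumr.
rewrite -mulr_sumr (sum_ctype (fun r s => (-1) ^+ (sumn r - size r) * LieChar n s)).
by congr (_ * _); apply: eq_bigr => s _; rewrite sumn_ctype sign_ctype.
Qed.

(** * Pairing the induced character with linear characters *)

Lemma sum_cfInd_twisted (gT : finGroupType) (H : {group gT}) (phi : 'CF(H))
    (w : gT -> algC) (c : gT) :
  {morph w : x y / (x * y)%g >-> x * y} -> phi \is a linear_char -> c \in H ->
  w c * phi c != 1 -> \sum_x w x * 'Ind[[set: gT]] phi x = 0.
Proof.
move=> wM lphi cH wc.
have S0 : \sum_x w x * phi x = 0.
  have e : \sum_x w x * phi x = w c * phi c * \sum_x w x * phi x.
    rewrite {1}(reindex_inj (mulgI c)) mulr_sumr; apply: eq_bigr => x _.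
    rewrite wM; have [xH|xH] := boolP (x \in H); first by rewrite lin_charM //; ring.
    have cx : phi (c * x)%g = 0 by rewrite cfun0 ?groupMl.
    by rewrite cx (cfun0 phi xH) !mulr0.
  apply/eqP; move/eqP: e; rewrite -subr_eq0 -{1}[\sum_x _]mul1r -mulrBl mulf_eq0.
  by rewrite subr_eq0 eq_sym (negPf wc).
transitivity (\sum_x \sum_y #|H|%:R^-1 * (w x * phi (x ^ y)%g)).
  apply: eq_bigr => x _; rewrite cfIndE ?subsetT // mulrCA mulr_sumr mulr_sumr.
  by apply: eq_big => // y; rewrite inE.
rewrite exchange_big big1 // => y _; rewrite -mulr_sumr.
rewrite (reindex_inj (conjg_inj y^-1%g)) /=.
under eq_bigr do rewrite -conjgM mulVg conjg1.
suff -> : \sum_x w (x ^ y^-1)%g * phi x = 0 by rewrite mulr0.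
rewrite -[RHS]S0; apply: eq_bigr => x _; rewrite conjgE invgK !wM mulrA.
have [xH|xH] := boolP (x \in H); last by rewrite cfun0 ?mulr0.
have w1 : w 1%g * w x = w x by rewrite -wM mul1g.
by rewrite -[w y * w x * _]mulrA [w x * _]mulrC mulrA -wM mulgV w1.
Qed.

(** By [sum_cfInd_twisted]: translating by the generator multiplies the sum over the cyclic subgroup
    by a factor other than 1, so that sum is zero, and induction only averages it over conjugates.
    In the default branch of [chi_zeta] the character itself is zero. *)
Lemma sum_LieChar_twisted n (w : 'S_n -> algC) :
  {morph w : x y / (x * y)%g >-> x * y} ->
  (forall z, n.-primitive_root z -> w (ncycle n) * z != 1) ->
  \sum_s w s * LieChar n s = 0.
Proof.
move=> wM wz; rewrite /LieChar /chi_zeta; case: pickP => [i /andP[li pi]|_].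
  by apply: sum_cfInd_twisted (wz _ pi) => //; exact: cycle_id.
by rewrite big1 // => s _; rewrite raddf0 cfunE mulr0.
Qed.

Lemma sum_ell0 n : (2 <= n)%N -> \sum_(r <- partitions n) ell n r = 0.
Proof.
move=> n2; rewrite sum_ell; under eq_bigr do rewrite -[LieChar n _]mul1r.
rewrite (sum_LieChar_twisted (w := fun=> 1)) ?mulr0 // => [x y|z pz].
  by rewrite mulr1.
rewrite mul1r; apply/eqP => z1; have := prim_order_dvd pz 1.
by rewrite expr1 z1 eqxx dvdn1 => /eqP n1; rewrite n1 in n2.
Qed.

Lemma sum_pi0 n : (3 <= n)%N -> \sum_(r <- partitions n) pi_ n r = 0.
Proof.
move=> n3; rewrite sum_pi (sum_LieChar_twisted (w := fun s : 'S_n => (-1) ^+ s)) ?mulr0 //.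
  by move=> x y; rewrite odd_permM signr_addb.
move=> z pz; apply/eqP => z1; have := prim_order_dvd pz 2.
(* The sign of the cycle times [z] being 1 forces [z] to square to 1, so [n] would divide 2. *)
have -> : z ^+ 2 = 1.
  by have := congr1 (fun x => x ^+ 2) z1; rewrite exprMn sqrr_sign mul1r expr1n.
by rewrite eqxx => /dvdn_leq; lia.
Qed.

(** * The case n = 2 *)

Lemma S2_cases (s : 'S_2) : s = 1%g \/ s = tperm ord0 ord_max.
Proof.
have [e|ne] := eqVneq s 1%g; [by left | right].
have e0 : s ord0 != ord0.
  apply: contra ne => /eqP e0; apply/eqP/permP => x; rewrite perm1.
  have [->//|x0] := eqVneq x ord0.
  have xm : x = ord_max by apply: val_inj; case: x x0 => -[|[|]].
  rewrite xm; have : s ord_max != ord0 by rewrite -e0 (inj_eq perm_inj).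
  by move=> h; apply: val_inj; case: (s ord_max) h => -[|[|]].
have em : s ord0 = ord_max by apply: val_inj; case: (s ord0) e0 => -[|[|]].
have e1 : s ord_max = ord0.
  have : s ord_max != ord_max by rewrite -em (inj_eq perm_inj).
  by move=> h; apply: val_inj; case: (s ord_max) h => -[|[|]].
apply/permP => x; have [->|x0] := eqVneq x ord0; first by rewrite tpermL.
have -> : x = ord_max by apply: val_inj; case: x x0 => -[|[|]].
by rewrite tpermR.
Qed.

Lemma neg1_neq1 : (-1 == 1 :> algC) = false.
Proof. by rewrite -subr_eq0 -opprD oppr_eq0 -(natrD _ 1 1) pnatr_eq0. Qed.

Lemma ctype2 (s : 'S_2) : ctype s = if s == 1%g then [:: 1; 1]%N else [:: 2]%N.
Proof.
have : ctype s \in partitions 2 by rewrite mem_partitions ctype_partition sumn_ctype.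
have := sign_ctype s; rewrite partitions2 !inE.
have n11 := negbT neg1_neq1.
case: (S2_cases s) => ->.
  rewrite odd_perm1 eqxx => e /orP[]/eqP e2 //; move: e; rewrite e2 expr1 => /eqP.
  by rewrite eq_sym (negPf n11).
rewrite odd_tperm /= => e /orP[]/eqP e2; move: e; rewrite e2.
  by rewrite expr1 => /eqP; rewrite (negPf n11).
by move=> _; case: eqP => // /(congr1 (fun t : 'S_2 => t ord0)); rewrite tpermL perm1.
Qed.

Lemma ncycle2 : ncycle 2 = tperm ord0 ord_max.
Proof.
have t1 : (tperm ord0 ord_max : 'S_2) != 1%g.
  by apply/eqP => /(congr1 (fun t : 'S_2 => t ord0)); rewrite tpermL perm1.
rewrite /ncycle; case: pickP => [s|/(_ (tperm ord0 ord_max))] /=.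
  rewrite ctype2; case: ifP => [//|/eqP s1 _].
  by case: (S2_cases s) => // /s1.
by rewrite ctype2 (negPf t1) eqxx.
Qed.

Lemma card_ncycle2 : #|<[ncycle 2]>%g| = 2%N.
Proof.
rewrite ncycle2; apply: (@nt_prime_order _ 2) => //.
  by rewrite expgS expg1 tperm2.
by apply/eqP => /(congr1 (fun t : 'S_2 => t ord0)); rewrite tpermL perm1.
Qed.

(** The default branch must be excluded: a nontrivial character of the group of order 2 has a value
    on the generator that squares to 1 and differs from 1, hence is -1, a primitive square root of
    unity. *)
Lemma chi_zeta2_1 : chi_zeta 2 1%g = 1.
Proof.
rewrite /chi_zeta; case: pickP => [i /andP[li _]|np]; first exact: lin_char1.
have cyc : cyclic <[ncycle 2]>%g by exact: cycle_cyclic.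
have cN : #|Iirr <[ncycle 2]>%G| = 2%N by rewrite card_Iirr_abelian ?cyclic_abelian // card_ncycle2.
have [i i0] : exists i : Iirr <[ncycle 2]>%G, i != 0.
  have /card_gt1P[x [y [_ _ xy]]] : (1 < #|Iirr <[ncycle 2]>%G|)%N by rewrite cN.
  by have [x0|] := eqVneq x 0; [exists y; rewrite -x0 eq_sym | exists x].
have li : 'chi_i \is a linear_char by exact: irr_cyclic_lin.
have := np i; rewrite li /= => /negP[].
have c2 : (ncycle 2 ^+ 2 = 1)%g by rewrite -[X in (_ ^+ X)%g]card_ncycle2 expg_order.
have sq : 'chi_i (ncycle 2) ^+ 2 = 1.
  by rewrite -lin_charX ?cycle_id // c2 lin_char1.
have ne : 'chi_i (ncycle 2) != 1.
  apply: contra i0 => /eqP e1; rewrite -(inj_eq irr_inj) irr0; apply/eqP/cfun_inP => x.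
  by case/cycleP => k ->; rewrite lin_charX ?cycle_id // e1 expr1n cfun1E mem_cycle.
move/eqP: sq; rewrite sqrf_eq1 (negPf ne) /= => /eqP ->.
apply/andP; split=> //; apply/forallP => -[[|[|k]] //] /= _; rewrite unity_rootE.
  by rewrite expr1 neg1_neq1.
by rewrite sqrrN expr1n !eqxx.
Qed.

Lemma ell2_11 : ell 2 [:: 1; 1]%N = 2%:R^-1.
Proof.
rewrite /ell /frob (big_pred1 1%g) => [|s]; last first.
  by rewrite /= ctype2; case: (s == 1%g).
rewrite /LieChar cfInd1 ?subsetT // chi_zeta2_1 mulr1.
have : (#|<[ncycle 2]>%g| * #|[set: 'S_2] : <[ncycle 2]>|%g)%N = 2%N.
  by rewrite Lagrange ?subsetT // cardsT card_Sn.
rewrite card_ncycle2 => h.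
have -> : #|[set: 'S_2] : <[ncycle 2]>|%g = 1%N by lia.
by rewrite mulr1.
Qed.

Lemma ell2_2 : ell 2 [:: 2]%N = - 2%:R^-1.
Proof.
have := sum_ell0 (leqnn 2); rewrite partitions2 !big_cons big_nil ell2_11 addr0 => /eqP.
by rewrite addrC addr_eq0 => /eqP.
Qed.

Lemma pi2_11 : pi_ 2 [:: 1; 1]%N = 2%:R^-1.
Proof. by rewrite /pi_ /omega ell2_11 mul1r. Qed.

Lemma pi2_2 : pi_ 2 [:: 2]%N = 2%:R^-1.
Proof. by rewrite /pi_ /omega ell2_2 expr1 mulrNN mul1r. Qed.

(** * Bounds and sharpness *)

Lemma tbounded_hpl_ell m n : (2 <= n)%N -> tbounded (m * n) (m * (n - 1)) (hpl m (ell n)).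
Proof. by move=> n2; apply: tbounded_pleth; [exact: hom_ell | exact: sum_ell0]. Qed.

Lemma tbounded_hpl_pi m n : (3 <= n)%N -> tbounded (m * n) (m * (n - 1)) (hpl m (pi_ n)).
Proof. by move=> n3; apply: tbounded_pleth; [exact: hom_pi | exact: sum_pi0]. Qed.

Lemma tbounded_epl_pi m n : (3 <= n)%N -> tbounded (m * n) (m * (n - 1)) (epl m (pi_ n)).
Proof. by move=> n3; apply: tbounded_pleth; [exact: hom_pi | exact: sum_pi0]. Qed.

Lemma tbounded_epl_pi2 m : tbounded (m * 2) m.+1 (epl m (pi_ 2)).
Proof.
split=> [|B iota Q]; first by apply: hom_pleth; exact: hom_pi.
by apply: (tev_eh2 _ _ _ _ _ _).1; [exact: hom_pi | exact: pi2_11 | exact: pi2_2].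
Qed.

(** The leading coefficient is h_m, so every h_k specializes to 1 and the 2 by 2 determinant is
    lower triangular with unit diagonal. *)
Lemma scoef_hpl_ell2 m : scoef (hpl m (ell 2)) [:: m; m] = 1.
Proof.
have tb : tbounded (m * 2) m (hpl m (ell 2)).
  by have := @tbounded_hpl_ell m 2 isT; rewrite muln1.
have dm : (m + sumn [:: m] = m * 2)%N by rewrite /=; lia.
rewrite (@scoef_top _ _ _ (m * 2) (fun=> 1)) //; last first.
  move=> g; have e : sumn [:: m] = (m * 2 - m)%N by rewrite /=; lia.
  rewrite dm [in RHS]e; apply: (@hall_top _ _ _ (hsym m)); first by lia.
    rewrite coef_tev_he2; [|exact: hom_ell|exact: ell2_11|exact: ell2_2].
    by rewrite (_ : m * 2 - m = m)%N //; lia.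
  move=> r pr sr; rewrite hsymE //; last by rewrite sr; lia.
  by rewrite mulVf ?zee_partition // big1.
rewrite det_trig; last first.
  apply/is_trig_mxP => i j ij; rewrite mxE; case: eqP => [i0|/eqP i0].
    by case: eqP ij => // ->; rewrite ltn0.
  by case: i i0 ij => -[|[|i]] //= li; case: j => -[|[|j]].
rewrite big1 // => i _; rewrite mxE; case: eqP => [_ //|/eqP i0].
by case: i i0 => -[|[|i]] //= li _; rewrite /jtev /= hev1; case: ifP => //; lia.
Qed.

(** The leading coefficient is e_m, so h_k specializes to 1 for [k <= 1] and to 0 beyond. Below the
    first row the entry h_(1+j-i) survives only for [j = i] and [j = i - 1]. *)
Lemma scoef_epl_pi2 m : scoef (epl m.+1 (pi_ 2)) (m.+2 :: nseq m 1%N) = 1.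
Proof.
have sn : sumn (nseq m 1%N) = m by rewrite sumn_nseq mul1n.
have dm : (m.+2 + sumn (nseq m 1) = m.+1 * 2)%N by rewrite sn; lia.
rewrite (@scoef_top _ _ _ (m.+1 * 2) (fun j => (-1) ^+ j.-1)); last 2 first.
- exact: tbounded_epl_pi2.
- move=> g; have e : sumn (nseq m 1%N) = (m.+1 * 2 - m.+2)%N by rewrite sn; lia.
  rewrite dm [in RHS]e; apply: (@hall_top _ _ _ (Defs.esym m)); first by lia.
    rewrite (tev_eh2 _ _ _ _ _ _).2 //; [|exact: hom_pi|exact: pi2_11|exact: pi2_2].
    by rewrite (_ : m.+1 * 2 - m.+2 = m)%N //; lia.
  move=> r pr sr; have sm : sumn r = m by rewrite sr; lia.
  rewrite /Defs.esym sm eqxx pr /= sgn_prod // sm -mulrA mulVf ?zee_partition //.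
  by rewrite mulr1.
have M (i j : 'I_(size (nseq m 1%N)).+1) : i != ord0 ->
    jtev m.+2 (nseq m 1%N) (fun j => (-1) ^+ j.-1) i j = (i <= j.+1)%N%:R * (j <= i)%N%:R.
  case: i => -[|i] //= li _; rewrite /jtev /= nth_nseq.
  have -> : (i < m)%N by move: li; rewrite size_nseq.
  case: ifP => ji.
    by rewrite (_ : (i.+1 <= j.+1)%N = false) ?mul0r //; lia.
  rewrite hev_sgn (_ : (i.+1 <= j.+1)%N = true) ?mul1r; last by lia.
  by congr (_%:R); congr nat_of_bool; lia.
rewrite det_trig; last first.
  apply/is_trig_mxP => i j ij; rewrite mxE; case: eqP => [i0|/eqP i0].
    by case: eqP ij => // ->; rewrite ltn0.
  by rewrite M // [(j <= i)%N]leqNgt ij mulr0.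
rewrite big1 // => i _; rewrite mxE; case: eqP => [_ //|/eqP i0].
by rewrite M // leqnSn leqnn mulr1.
Qed.

Lemma sharply_bounded_by f N l : bounded f N -> is_partition l -> scoef f l != 0 ->
  head 0%N l = N -> sharply_bounded f N.
Proof. by move=> bf pl fl h; split=> // M /(_ l pl fl); rewrite h. Qed.

Lemma is_partition_nseq k m p : (0 < p <= k)%N -> is_partition (k :: nseq m p).
Proof.
case/andP=> p0; elim: m k => [|m IH] k pk; rewrite is_partition_cons (leq_trans p0 pk) //.
rewrite all_nseq [geq k p]pk orbT; exact: IH.
Qed.

Lemma sum_undup_count (w : nat -> nat) l :
  (\sum_(j <- undup l) count_mem j l * w j = \sum_(j <- l) w j)%N.
Proof.
rewrite -[RHS]big_undup_iterop_count; apply: eq_bigr => j _.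
by elim: (count_mem j l) => // -[|n] /= IH; rewrite ?mul1n // mulSn IH.
Qed.

Lemma prankE l : is_partition l -> prank l = (\sum_(j <- l) (j - 1))%N.
Proof.
move/is_partition_gt0; rewrite /prank; elim: l => [|j l IH] /=; first by rewrite big_nil.
case/andP=> j0 al; rewrite big_cons -IH //.
have : (size l <= sumn l)%N by elim: l al {IH} => //= y r IH /andP[y0 /IH]; lia.
lia.
Qed.

Lemma tbounded_chLie l : is_partition l -> 1%N \notin l ->
  tbounded (sumn l) (prank l) (chLie l).
Proof.
move=> pl l1; rewrite prankE // sumnE -(sum_undup_count id l) -(sum_undup_count (subn^~ 1%N) l) /chLie.
apply: (@tbounded_prod _ _ (fun j => count_mem j l * j)%N (fun j => count_mem j l * (j - 1))%N).
move=> j; rewrite mem_undup => jl; apply: tbounded_hpl_ell.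
have := partition_part_gt0 pl jl; have : j != 1%N by apply: contraNneq l1 => <-.
lia.
Qed.

Lemma tbounded_chW l : is_partition l -> 1%N \notin l ->
  tbounded (sumn l) (prank l).+1 (chW l).
Proof.
move=> pl l1.
(* Only the factor e_m[pi_2] exceeds [m * (j - 1)], by one, and it occurs at most once. *)
apply: (@tbounded_le _ (\sum_(j <- undup l) (count_mem j l * (j - 1) + (j == 2)))%N).
  rewrite big_split /= (sum_undup_count (subn^~ 1%N) l) -prankE // -[X in (_ <= X)%N]addn1; apply: leq_add => //.
  have [l2|l2] := boolP (2%N \in undup l).
    rewrite (bigD1_seq 2%N l2 (undup_uniq l)) /= big1 // => j.
    by case: (j == 2%N).
  rewrite big_seq big1 // => j jl; case: eqP => // j2.
  by rewrite -j2 jl in l2.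
rewrite sumnE -(sum_undup_count id l) /chW.
apply: (@tbounded_prod _ _ (fun j => count_mem j l * j)%N (fun j => count_mem j l * (j - 1) + (j == 2))%N).
move=> j; rewrite mem_undup => jl.
have := partition_part_gt0 pl jl; have : j != 1%N by apply: contraNneq l1 => <-.
have [->|j2] := eqVneq j 2%N.
  by rewrite muln1 addn1 => _ _; exact: tbounded_epl_pi2.
rewrite addn0 => j1 j0; have j3 : (3 <= j)%N by lia.
by case: ifP => _; [exact: tbounded_hpl_pi | exact: tbounded_epl_pi].
Qed.

Lemma scoef_ext f g l : (forall r, is_partition r -> sumn r = sumn l -> f r = g r) ->
  scoef f l = scoef g l.
Proof.
move=> fg; apply: eq_big_seq => r; rewrite mem_partitions => /andP[pr /eqP sr].
by rewrite fg.
Qed.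

Lemma mulf_onef f r : is_partition r -> mulf f onef r = f r.
Proof.
move=> pr; rewrite /mulf (bigD1_seq (r, [::])) ?undup_uniq //=; last first.
  by rewrite mem_splits // pr cats0 perm_refl.
rewrite /onef eqxx mulr1 big_seq_cond big1 ?addr0 // => -[s t] /andP[].
rewrite mem_splits // => /and3P[/= ps _ pst] ne.
case: eqP => [t0|_]; last by rewrite mulr0.
move: ne pst; rewrite t0 cats0 => ne /(partition_eqP ps pr) sr.
by rewrite sr eqxx in ne.
Qed.

(** Common form of [hatLie] and [hatW], which are convertible to it. *)
Definition hat (F : seq nat -> symf) (i : nat) : symf := fun r =>
  \sum_(l <- partitions (sumn r) | (1%N \notin l) && (prank l == i)) F l r.

Lemma scoef_hat F i mu : scoef (hat F i) mu =
  \sum_(l <- partitions (sumn mu) | (1%N \notin l) && (prank l == i)) scoef (F l) mu.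
Proof.
rewrite exchange_big; apply: eq_big_seq => r; rewrite mem_partitions => /andP[_ /eqP sr].
by rewrite /hat sr [X in X * _]mulr_sumr mulr_suml.
Qed.

(** All parts are at least 2, so twice the length is at most the size; equality forces every part to
    be 2. *)
Lemma sumn_le_prank l : is_partition l -> 1%N \notin l ->
  (sumn l <= 2 * prank l ?= iff (l == nseq (prank l) 2%N))%N.
Proof.
move=> pl l1; have {pl l1} : all (leq 2) l.
  apply/allP => j jl; have := partition_part_gt0 pl jl.
  have : j != 1%N by apply: contraNneq l1 => <-.
  by case: j {jl} => [|[|]].
have le : forall s : seq nat, all (leq 2) s -> (2 * size s <= sumn s)%N.
  by elim=> //= j s IH /andP[j2 /IH]; lia.
rewrite /prank; move=> a; split; first by have := le _ a; lia.
apply/eqP/eqP => [|e]; last by have := le _ a; have := congr1 sumn e; rewrite sumn_nseq; lia.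
elim: l a => //= j l IH /andP[j2 al] e; have := le _ al => h.
have -> : j = 2%N by lia.
rewrite {1}IH //; last by lia.
by rewrite (_ : 2 + sumn l - (size l).+1 = (sumn l - size l).+1)%N //; lia.
Qed.

(** The bounds [2 * i] on the size and [N] on the first row hold separately and are both attained at
    [nu]: in degree [2 * i] only the partition 2^i contributes, so its coefficient cannot cancel. *)
Lemma max_hat F N i nu : (1 <= i)%N ->
  (forall l, is_partition l -> 1%N \notin l -> prank l = i -> bounded (F l) N) ->
  is_partition nu -> sumn nu = (2 * i)%N -> head 0%N nu = N ->
  scoef (F (nseq i 2%N)) nu != 0 -> max_size_plus_first (hat F i) (2 * i + N).
Proof.
move=> i1 bF pnu snu hnu fnu; split.
  exists nu; split=> //; last by rewrite snu hnu.
  have pi2 : is_partition (nseq i 2%N).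
    by case: (i) i1 => // j _; exact: is_partition_nseq.
  have n1 : 1%N \notin nseq i 2%N by apply/negP => /nseqP[].
  have pri : prank (nseq i 2%N) = i by rewrite /prank sumn_nseq size_nseq; lia.
  rewrite scoef_hat big_mkcond (bigD1_seq (nseq i 2%N)) ?partitions_uniq //=; last first.
    by rewrite mem_partitions pi2 snu sumn_nseq eqxx.
  rewrite n1 pri eqxx big_seq_cond big1 ?addr0 // => l /andP[].
  rewrite mem_partitions snu => /andP[pl /eqP sl] ne.
  case: ifP => // /andP[l1 /eqP pr].
  have := (sumn_le_prank pl l1).2; rewrite pr sl eqxx => /esym ne'.
  by rewrite ne' in ne.
move=> l pl; rewrite scoef_hat => fl.
have [l' l'in /andP[/andP[l1 /eqP pr] fl']] : exists2 l', l' \in partitions (sumn l) &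
    ((1%N \notin l') && (prank l' == i)) && (scoef (F l') l != 0).
  apply/hasP; apply: contraNT fl => /hasPn h; rewrite big_seq_cond big1 // => l' /andP[/h].
  by move=> h' c; move: h'; rewrite c /= negbK => /eqP.
move: l'in; rewrite mem_partitions => /andP[pl' /eqP sl'].
have := (sumn_le_prank pl' l1).1; have := bF _ pl' l1 pr l pl fl'.
by rewrite sl' pr => *; apply: leq_add.
Qed.

Local Close Scope ring_scope.

Theorem mainTheorem14 :
  (forall m n : nat, (1 <= m)%N -> (3 <= n)%N ->
     [/\ bounded (hpl m (ell n)) (m * (n - 1)),
         bounded (hpl m (pi_ n)) (m * (n - 1)),
         bounded (epl m (ell n)) (m * (n - 1)) &
         bounded (epl m (pi_ n)) (m * (n - 1))]) /\
  (forall m : nat, (1 <= m)%N -> sharply_bounded (hpl m (ell 2)) m) /\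
  (forall m : nat, (1 <= m)%N -> sharply_bounded (epl m (pi_ 2)) m.+1) /\
  (forall (l : seq nat) (i : nat), is_partition l -> 1%N \notin l -> prank l = i ->
     bounded (chLie l) i /\ bounded (chW l) i.+1) /\
  (forall i : nat, (1 <= i)%N ->
     max_size_plus_first (hatLie i) (3 * i) /\
     max_size_plus_first (hatW i) (3 * i).+1).
Proof.
have bLie l i : is_partition l -> 1%N \notin l -> prank l = i -> bounded (chLie l) i.
  by move=> pl l1 <-; exact: tbounded_bounded (tbounded_chLie pl l1).
have bW l i : is_partition l -> 1%N \notin l -> prank l = i -> bounded (chW l) i.+1.
  by move=> pl l1 <-; exact: tbounded_bounded (tbounded_chW pl l1).
have un i : 0 < i -> undup (nseq i 2) = [:: 2].
  by case: i => // i _; elim: i => //= i ->.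
have cn i : count_mem 2 (nseq i 2) = i by rewrite count_nseq mul1n.
split.
  move=> m n _ n3; split; apply: tbounded_bounded; apply: tbounded_pleth.
  - exact: hom_ell. - by apply: sum_ell0; exact: ltnW.
  - exact: hom_pi. - exact: sum_pi0.
  - exact: hom_ell. - by apply: sum_ell0; exact: ltnW.
  - exact: hom_pi. - exact: sum_pi0.
split.
  move=> m m1; apply: (@sharply_bounded_by _ _ [:: m; m]) => //.
  - by have := tbounded_bounded (@tbounded_hpl_ell m 2 isT); rewrite muln1.
  - by apply: (@is_partition_nseq m 1 m); rewrite m1 leqnn.
  - by rewrite scoef_hpl_ell2 oner_eq0.
split.
  case=> // m _; apply: (@sharply_bounded_by _ _ (m.+2 :: nseq m 1)) => //.
  - exact: tbounded_bounded (tbounded_epl_pi2 _).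
  - exact: is_partition_nseq.
  - by rewrite scoef_epl_pi2 oner_eq0.
split; first by move=> l i pl l1 pr; split; [exact: bLie | exact: bW].
move=> i i1; split.
  rewrite mulSn addnC; apply: (@max_hat chLie i i [:: i; i]) => //.
  - by move=> l; exact: bLie.
  - by apply: (@is_partition_nseq i 1 i); rewrite i1 leqnn.
  (* For 2^i the product [chLie] has a single factor, up to the unit [onef]. *)
  rewrite (scoef_ext (g := hpl i (ell 2))) ?scoef_hpl_ell2 ?oner_eq0 // => r pr _.
  by rewrite /chLie un //= cn mulf_onef.
rewrite mulSn addnC -addnS; case: i i1 => // i _.
apply: (@max_hat chW i.+2 i.+1 (i.+2 :: nseq i 1)) => //.
- by move=> l; exact: bW.
- exact: is_partition_nseq.
- by rewrite /= sumn_nseq; lia.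
rewrite (scoef_ext (g := epl i.+1 (pi_ 2))) ?scoef_epl_pi2 ?oner_eq0 // => r pr _.
by rewrite /chW un //= -/(nseq i.+1 2) mulf_onef // -{1}(cn i.+1).
Qed.
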